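(* Let $n\ge2$, let $P$ be a positive regular polynomial $n$-tuple and let $m\in\mathbb N^n$. For $\alpha\in\mathbb Z_+^n$ define $e_\alpha:\triangle^n_P\to\mathbb C$ by $$e_\alpha(z)=\frac{\sqrt{A_{P,m}(\alpha)}\,\varphi(z)^\alpha}{\prod_{j=2}^nz_j},\qquad z\in\triangle^n_P.$$ Then $\{e_\alpha\}_{\alpha\in\mathbb Z_+^n}$ forms an orthonormal basis for $\mathscr H^2_m(\triangle^n_P)$. Moreover: (i) the linear span of the functions $\displaystyle\prod_{j=1}^{n-1}\Big(\frac{z_j}{z_{j+1}}\Big)^{\alpha_j}\frac{z_n^{\alpha_n}}{\prod_{j=2}^nz_j}$, $\alpha_1,\ldots,\alpha_n\in\mathbb Z_+$, is dense in $\mathscr H^2_m(\triangle^n_P)$; (ii) for any $f\in\mathscr H^2_m(\triangle^n_P)$, the series $\sum_{\alpha\in\mathbb Z_+^n}\langle f,e_\alpha\rangle e_\alpha$ converges compactly (uniformly on compact subsets) on $\triangle^n_P$ to $f$.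
   Context: $\mathbb N$ = positive integers, $\mathbb Z_+$ = nonnegative integers, $\mathbb C_*=\mathbb C\setminus\{0\}$, $z\diamond w=(z_1w_1,\ldots,z_nw_n)$, and $\overline z$ is the entrywise conjugate. For $n\ge2$ let $\varphi(z)=\big(\frac{z_1}{z_2},\ldots,\frac{z_{n-1}}{z_n},z_n\big)$ for $z\in\mathbb C\times\mathbb C_*^{n-1}$. A polynomial $n$-tuple $P=(P_1,\ldots,P_n)$ in $\mathbb C[z_1,\ldots,z_n]$ is positive regular if for each $j$, $P_j$ has nonnegative coefficients and $P_j(z)=a_jz_j+\sum_{k=2}^{N_j}Q_{jk}(z)$ with $a_j>0$ and $Q_{jk}$ homogeneous of degree $k$. The $P$-triangle is $\triangle^n_P=\{z\in\mathbb C\times\mathbb C_*^{n-1}: P_j(\varphi(z)\diamond\overline{\varphi(z)})<1,\ j=1,\ldots,n\}$. For $m\in\mathbb N^n$, $\mathscr H^2_m(\triangle^n_P)$ is the reproducing kernel Hilbert space associated with the positive semi-definite kernel $$\mathscr K_{P,m}(z,w)=\prod_{j=2}^n\frac1{z_j\overline w_j}\prod_{j=1}^n\frac1{\big(1-P_j(\varphi(z)\diamond\overline{\varphi(w)})\big)^{m_j}},\qquad z,w\in\triangle^n_P.$$ The coefficient-function $A_{P,m}:\mathbb Z_+^n\to(0,\infty)$ is defined by the power series expansion near the origin $\prod_{j=1}^n(1-P_j(x))^{-m_j}=\sum_{\alpha\in\mathbb Z_+^n}A_{P,m}(\alpha)x^\alpha$. *)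

(* Defs.v *)
(* [mpoly] is imported without its
   notations, which clash with those of MathComp-Analysis:
     mpoly n C is {mpoly C[n]},  multinom n is 'X_{1..n},  mcoeff a p is p@_a,
     meval v p is p.@[v],  mpolyX C (mnm1 j) is 'X_j,
     p \is ishomog1 d mdeg is p \is d.-homog. *)
From HB Require Import structures.
From mathcomp Require Import all_boot all_order all_algebra.
From mathcomp.real_closed Require Import complex.
From mathcomp Require Import finmap all_classical all_reals all_analysis.
From mathcomp.analysis Require Import showcase.summability.
From mathcomp.multinomials Require mpoly.
Import -(notations) mpoly.

Set Implicit Arguments.
Unset Strict Implicit.
Unset Printing Implicit Defensive.

Import Order.TTheory GRing.Theory Num.Theory.
Import numFieldNormedType.Exports.

Local Open Scope classical_set_scope.
Local Open Scope ring_scope.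

(* The field R[i], packed so that MathComp-Analysis equips it with the topology
   of a numFieldType.  In its (partial) order, [x < y] forces [y - x] to be real;
   in particular [0 < x] says that x is a positive real number. *)
Definition cplx (R : realType) : numClosedFieldType := R[i].

Definition of_real (R : realType) (r : R) : cplx R := r%:C%C.

(* The Hilbert space of functions on X with reproducing kernel K.  It is unique
   by the Moore-Aronszajn theorem; the values of [ip] outside of the carrier are
   irrelevant.  The inner product is linear in its first argument. *)
Record rkhs (R : realType) (X : Type) (K : X -> X -> cplx R) := Rkhs {
  rkhs_carrier : set (X -> cplx R);
  ip : (X -> cplx R) -> (X -> cplx R) -> cplx R;
  rkhs0 : rkhs_carrier 0;
  rkhs_linear : forall (a : cplx R) f g,
    rkhs_carrier f -> rkhs_carrier g -> rkhs_carrier (a *: f + g);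
  ip_linear : forall (a : cplx R) f g h,
    rkhs_carrier f -> rkhs_carrier g -> rkhs_carrier h ->
    ip (a *: f + g) h = a * ip f h + ip g h;
  ip_conj : forall f g, rkhs_carrier f -> rkhs_carrier g ->
    ip g f = (ip f g)^*;
  ip_gt0 : forall f, rkhs_carrier f -> f <> 0 -> 0 < ip f f;
  rkhs_complete : forall u : nat -> X -> cplx R,
    (forall k, rkhs_carrier (u k)) ->
    (forall eps : cplx R, 0 < eps -> exists N, forall i j,
       (N <= i)%N -> (N <= j)%N -> sqrtC (ip (u i - u j) (u i - u j)) < eps) ->
    exists2 f, rkhs_carrier f &
      sqrtC (ip (u k - f) (u k - f)) @[k --> \oo] --> (0 : cplx R);
  rkhs_kernel : forall w, rkhs_carrier (K ^~ w);
  rkhs_reproducing : forall f w, rkhs_carrier f -> f w = ip f (K ^~ w) }.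

Section HilbertSpaceNotions.
Context {R : realType} {X : Type} {K : X -> X -> cplx R} (H : rkhs K).

Definition hnorm (f : X -> cplx R) : cplx R := sqrtC (ip H f f).

Definition hdense (S : set (X -> cplx R)) : Prop :=
  S `<=` rkhs_carrier H /\
  forall f, rkhs_carrier H f -> forall eps : cplx R, 0 < eps ->
    exists2 g, S g & hnorm (f - g) < eps.

Definition lin_span {I : choiceType} (e : I -> X -> cplx R) :
    set (X -> cplx R) :=
  [set g | exists (F : {fset I}) (c : I -> cplx R),
             g = partial_sum (fun i => c i *: e i) F].

Definition orthonormal_basis {I : choiceType} (e : I -> X -> cplx R) : Prop :=
  [/\ forall i, rkhs_carrier H (e i),
      forall i j, ip H (e i) (e j) = (i == j)%:R
    & hdense (lin_span e)].

End HilbertSpaceNotions.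

Section PTriangle.
Context {R : realType} {n : nat}.
Local Notation C := (cplx R).
Implicit Types (P : 'I_n -> mpoly n C) (m : 'I_n -> nat).
Implicit Types (z w x : 'rV[C]_n) (a : multinom n).

Definition hadamard z w : 'rV[C]_n := map2_mx *%R z w.

Definition conj_row z : 'rV[C]_n := map_mx Num.conj z.

Definition monomial x a : C := \prod_(j < n) x 0 j ^+ a j.

(* Indices start at 0, so that [j.+1 < n] excludes exactly the last coordinate;
   for the other ones, [ordS j] has value j + 1. *)
Definition phi z : 'rV[C]_n :=
  \row_j (if (j.+1 < n)%N then z 0 j / z 0 (ordS j) else z 0 j).

(* The product z_2 ... z_n of all coordinates but the first one. *)
Definition tail_prod z : C := \prod_(j < n | (0 < j)%N) z 0 j.

Definition positive_regular P : Prop :=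
  forall j : 'I_n,
    (forall a, 0 <= mcoeff a (P j)) /\
    exists (c : C) (N : nat) (Q : nat -> mpoly n C),
      [/\ 0 < c,
          forall k, Q k \is ishomog1 k mdeg
        & P j = c *: mpolyX C (mnm1 j) + \sum_(2 <= k < N.+1) Q k].

Definition triangle P : set 'rV[C]_n :=
  [set z : 'rV[C]_n | (forall j : 'I_n, (0 < j)%N -> z 0 j != 0) /\
           forall j : 'I_n,
             meval (hadamard (phi z) (conj_row (phi z)) 0) (P j) < 1].

Definition triangle_kernel P m (z w : triangle P) : C :=
  (tail_prod (hadamard (\val z) (conj_row (\val w))))^-1 *
  \prod_(j < n)
    (1 - meval (hadamard (phi (\val z)) (conj_row (phi (\val w))) 0) (P j))
      ^- m j.

(* The multiple power series converges unconditionally, that is, along the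
   directed set of all finite sets of exponents. *)
Definition coefficient_function P m (A : multinom n -> R) : Prop :=
  (forall a, 0 < A a) /\
  \forall x \near (0 : 'rV[C]_n),
    partial_sum (fun a => of_real (A a) * monomial x a) F @[F --> totally] -->
      \prod_(j < n) (1 - meval (x 0) (P j)) ^- m j.

Definition basis_fun P (A : multinom n -> R) a (z : triangle P) : C :=
  of_real (Num.sqrt (A a)) * monomial (phi (\val z)) a / tail_prod (\val z).

Definition span_fun P a (z : triangle P) : C :=
  monomial (phi (\val z)) a / tail_prod (\val z).

End PTriangle.

Arguments triangle_kernel {R n} P m z w.
Arguments basis_fun {R n} P A a z.
Arguments span_fun {R n} P a z.

(* Main.v *)
(* Write e_a for the candidate basis.  The geometric series expands
   prod_j (1 - P_j(x))^(-m_j) with nonnegative coefficients wherever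
   P_j(|x|) < 1 for all j, and the AM-GM inequality puts
   x = phi(z) <> conj (phi(w)) in that domain; since the coefficients of a power
   series are unique, K(z, w) = sum_a e_a(z) conj (e_a(w)) on the whole triangle.
   Hence a finite combination h = sum_i t_i K_(w_i) has squared norm
   sum_a |v_a|^2, where v_a = sum_i t_i conj (e_a(w_i)), and the Riesz
   representation theorem applied to h |-> sum_a conj (c_a) v_a places every
   finite combination sum_a c_a e_a in H, with norm at most |c|_2.
   It follows that K_w - sum_(a in F) conj (e_a(w)) e_a tends to 0 in H, so that
   f(w) = sum_a <f, e_a> e_a(w) for all f in H; taking f = e_b, uniqueness of
   the coefficients gives orthonormality.  Density is a second application of
   Riesz, and |f(z) - S(z)|^2 <= |f - S|^2 K(z, z) makes the convergence uniform
   on compact sets, where K(z, z) is bounded. *)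
Require Import Defs.
From mathcomp Require Import all_boot all_order all_algebra.
From mathcomp.real_closed Require Import complex.
From mathcomp Require Import finmap all_classical all_reals all_analysis.
From mathcomp.analysis Require Import showcase.summability.
From mathcomp Require Import ring lra.
From mathcomp.multinomials Require mpoly.
Import -(notations) mpoly.

Set Implicit Arguments.
Unset Strict Implicit.
Unset Printing Implicit Defensive.

Import Order.TTheory GRing.Theory Num.Theory.
Import numFieldNormedType.Exports.
Local Open Scope classical_set_scope.
Local Open Scope ring_scope.

(** * Real parts and real scalars in [cplx R] *)

Section RealParts.
Context {R : realType}.
Local Notation C := (cplx R).
Local Notation Re := (@complex.Re R).

Lemma ReD (x y : C) : Re (x + y) = Re x + Re y.
Proof. by case: x y => [? ?] [? ?]. Qed.

Lemma ReN (x : C) : Re (- x) = - Re x.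
Proof. by case: x. Qed.

Lemma Re_sum (I : Type) (r : seq I) (F : I -> C) :
  Re (\sum_(i <- r) F i) = \sum_(i <- r) Re (F i).
Proof. by apply: (big_morph Re ReD). Qed.

Lemma Re_realM (t : R) (x : C) : Re (of_real t * x) = t * Re x.
Proof. by case: x => a b /=; rewrite mul0r subr0. Qed.

Lemma Re_conj (x : C) : Re x^* = Re x.
Proof. by case: x. Qed.

Lemma of_realD (s t : R) : of_real (s + t) = of_real s + of_real t.
Proof. exact: rmorphD. Qed.

Lemma of_realM (s t : R) : of_real (s * t) = of_real s * of_real t.
Proof. exact: rmorphM. Qed.

Lemma of_realN (s : R) : of_real (- s) = - of_real s.
Proof. exact: rmorphN. Qed.

Lemma of_real0 : of_real (0 : R) = 0.
Proof. by []. Qed.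

Lemma of_real1 : of_real (1 : R) = 1.
Proof. by []. Qed.

Lemma of_realX (s : R) k : of_real (s ^+ k) = of_real s ^+ k.
Proof. exact: rmorphXn. Qed.

Lemma le_of_real (s t : R) : (of_real s <= of_real t) = (s <= t).
Proof. exact: lecR. Qed.

Lemma lt_of_real (s t : R) : (of_real s < of_real t) = (s < t).
Proof. exact: ltcR. Qed.

Lemma conj_of_real (t : R) : (of_real t)^* = of_real t.
Proof. exact: conjc_real. Qed.

Lemma ge0_of_real (x : C) : 0 <= x -> x = of_real (Re x).
Proof. by move=> x0; rewrite -[LHS](RRe_real (ger0_real x0)). Qed.

Lemma gt0_of_real (x : C) : 0 < x -> 0 < Re x.
Proof. by move=> x0; rewrite -lt_of_real -ge0_of_real// ltW. Qed.

(* Multiplying by [- 'i] reduces the equality of imaginary parts to real parts. *)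
Lemma eq_Re_scale (x y : C) :
  (forall a : C, Re (a * x) = Re (a * y)) -> x = y.
Proof.
move=> xy; apply/eqP; rewrite eq_complex.
have := xy 1; rewrite !mul1r => ->; rewrite eqxx /=.
have := xy (Complex 0 (-1)); case: x y {xy} => [a b] [c d] /=.
by rewrite !mul0r !sub0r !mulN1r !opprK => ->.
Qed.

Lemma sqrtC_of_real (t : R) (s : R) : 0 <= t -> 0 < s ->
  (sqrtC (of_real t) < of_real s) = (t < s ^+ 2).
Proof.
move=> t0 s0.
have t0' : (0 : cplx R) <= of_real t by rewrite -of_real0 le_of_real.
have s0' : (0 : cplx R) <= of_real s by rewrite -of_real0 le_of_real ltW.
rewrite -(@ltr_pXn2r _ 2) ?nnegrE ?sqrtC_ge0//.
by rewrite sqrtCK -of_realX lt_of_real.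
Qed.

End RealParts.

(** * The carrier as a real Hilbert space *)

Lemma discriminant_le (R : realType) (q c d : R) : 0 <= q ->
  (forall t, 0 <= q * t ^+ 2 + 2 * c * t + d) -> c ^+ 2 <= q * d.
Proof.
rewrite le_eqVlt => /predU1P[<- H|q0 /(_ (- c / q))].
  rewrite mul0r; have [->|c0] := eqVneq c 0; first by rewrite expr0n.
  (* With [q = 0], this [t] gives the polynomial the value -1. *)
  have := H (- (d + 1) / (2 * c)).
  rewrite mul0r add0r mulrC divfK ?mulf_neq0 ?pnatr_eq0// => h.
  lra.
have -> : q * (- c / q) ^+ 2 + 2 * c * (- c / q) + d = (q * d - c ^+ 2) / q.
  by field; rewrite gt_eqF.
by rewrite pmulr_lge0 ?invr_gt0// subr_ge0.
Qed.

Section RealHilbert.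
Context {R : realType} {X : Type} {K : X -> X -> cplx R} (H : rkhs K).
Local Notation C := (cplx R).
Local Notation V := (rkhs_carrier H).
Local Notation Re := (@complex.Re R).
Implicit Types f g h : X -> C.

(** The real part turns the carrier into a real inner product space, whose order and quadratic
    polynomials live in [R]. *)
Definition reip f g : R := Re (ip H f g).
Definition sqn f : R := reip f f.

Lemma carrierD f g : V f -> V g -> V (f + g).
Proof. by move=> Vf Vg; rewrite -[f]scale1r; exact: rkhs_linear. Qed.

Lemma carrierZ a f : V f -> V (a *: f).
Proof. by move=> Vf; rewrite -[_ *: _]addr0; apply: rkhs_linear => //; exact: rkhs0. Qed.

Lemma carrierB f g : V f -> V g -> V (f - g).
Proof. by move=> Vf Vg; rewrite -scaleN1r; exact: carrierD Vf (carrierZ _ Vg). Qed.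

Lemma carrier_sum (I : Type) (r : seq I) (F : I -> X -> C) :
  (forall i, V (F i)) -> V (\sum_(i <- r) F i).
Proof. by move=> VF; elim/big_ind: _ => //; [exact: rkhs0|exact: carrierD]. Qed.

Lemma ip0l h : V h -> ip H 0 h = 0.
Proof.
move=> Vh; have := ip_linear 1 (rkhs0 H) (rkhs0 H) Vh.
by rewrite scaler0 addr0 mul1r => /eqP; rewrite -subr_eq0 opprD addNKr oppr_eq0 => /eqP.
Qed.

Lemma ipD f g h : V f -> V g -> V h -> ip H (f + g) h = ip H f h + ip H g h.
Proof. by move=> Vf Vg Vh; rewrite -{1}[f]scale1r ip_linear// mul1r. Qed.

Lemma ipZ a f h : V f -> V h -> ip H (a *: f) h = a * ip H f h.
Proof.
by move=> Vf Vh; rewrite -[_ *: _]addr0 ip_linear ?ip0l ?addr0//; exact: rkhs0.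
Qed.

Lemma ipB f g h : V f -> V g -> V h -> ip H (f - g) h = ip H f h - ip H g h.
Proof.
move=> Vf Vg Vh; have Vg' := carrierZ (-1) Vg.
by rewrite -(scaleN1r g) ipD// ipZ// mulN1r.
Qed.

Lemma ip_sum (I : Type) (r : seq I) (F : I -> X -> C) h :
  (forall i, V (F i)) -> V h ->
  ip H (\sum_(i <- r) F i) h = \sum_(i <- r) ip H (F i) h.
Proof.
move=> VF Vh; elim: r => [|i r IH]; first by rewrite !big_nil ip0l.
by rewrite !big_cons ipD ?IH//; exact: carrier_sum.
Qed.

Lemma ipZr a f h : V f -> V h -> ip H f (a *: h) = a^* * ip H f h.
Proof.
move=> Vf Vh; have Vh' := carrierZ a Vh.
by rewrite (ip_conj Vh' Vf) ipZ// rmorphM /= -(ip_conj Vh Vf).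
Qed.

Lemma ip_sumr (I : Type) (r : seq I) (F : I -> X -> C) h :
  (forall i, V (F i)) -> V h ->
  ip H h (\sum_(i <- r) F i) = \sum_(i <- r) ip H h (F i).
Proof.
move=> VF Vh; rewrite (ip_conj (carrier_sum _ VF) Vh) ip_sum// rmorph_sum.
by apply: eq_bigr => i _; exact/esym/ip_conj.
Qed.

Lemma ip_sqn f : V f -> ip H f f = of_real (sqn f).
Proof.
move=> Vf; apply: ge0_of_real; have [->|f0] := pselect (f = 0).
  by rewrite (ip0l (rkhs0 H)).
exact/ltW/ip_gt0.
Qed.

Lemma sqn_ge0 f : V f -> 0 <= sqn f.
Proof.
move=> Vf; have [->|f0] := pselect (f = 0).
  by rewrite /sqn /reip (ip0l (rkhs0 H)).
exact/ltW/gt0_of_real/ip_gt0.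
Qed.

Lemma reipC f g : V f -> V g -> reip f g = reip g f.
Proof. by move=> Vf Vg; rewrite /reip ip_conj// Re_conj. Qed.

Lemma reipD f g h : V f -> V g -> V h -> reip (f + g) h = reip f h + reip g h.
Proof. by move=> *; rewrite /reip ipD// ReD. Qed.

Lemma reipB f g h : V f -> V g -> V h -> reip (f - g) h = reip f h - reip g h.
Proof. by move=> *; rewrite /reip ipB// ReD ReN. Qed.

Lemma reipZ t f h : V f -> V h -> reip (of_real t *: f) h = t * reip f h.
Proof. by move=> *; rewrite /reip ipZ// Re_realM. Qed.

Lemma sqn_lin t f g : V f -> V g ->
  sqn (of_real t *: f + g) = sqn f * t ^+ 2 + 2 * reip f g * t + sqn g.
Proof.
move=> Vf Vg; have Vt := carrierZ (of_real t) Vf.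
have Vs := carrierD Vt Vg.
rewrite /sqn reipD// !(@reipC _ (of_real t *: f + g))// !reipD// !reipZ//.
rewrite (@reipC f (_ *: _))// (@reipC g (_ *: _))// !reipZ//.
ring.
Qed.

Lemma sqn_D f g : V f -> V g -> sqn (f + g) = sqn f + 2 * reip f g + sqn g.
Proof. by move=> Vf Vg; have := sqn_lin 1 Vf Vg; rewrite scale1r expr1n !mulr1. Qed.

Lemma sqn_B f g : V f -> V g -> sqn (f - g) = sqn f - 2 * reip f g + sqn g.
Proof.
move=> Vf Vg; have := sqn_lin (-1) Vg Vf.
rewrite of_realN scaleN1r addrC => ->; rewrite (reipC Vg Vf); ring.
Qed.

Lemma sqn_subC f g : V f -> V g -> sqn (f - g) = sqn (g - f).
Proof. by move=> Vf Vg; rewrite !sqn_B// (reipC Vf Vg); ring. Qed.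

(** Cauchy-Schwarz, from the discriminant of the nonnegative polynomial
    [t |-> sqn (of_real t *: f + g)]. *)
Lemma reip_le f g : V f -> V g -> reip f g ^+ 2 <= sqn f * sqn g.
Proof.
move=> Vf Vg; apply: discriminant_le => [|t]; first exact: sqn_ge0.
by rewrite -sqn_lin//; apply/sqn_ge0/carrierD => //; exact: carrierZ.
Qed.

Lemma hnormE f (s : R) : V f -> 0 < s -> (hnorm H f < of_real s) = (sqn f < s ^+ 2).
Proof. by move=> Vf s0; rewrite /hnorm ip_sqn// sqrtC_of_real//; exact: sqn_ge0. Qed.

Lemma carrier_complete (u : nat -> X -> C) :
  (forall k, V (u k)) ->
  (forall e : R, 0 < e -> exists N, forall i j,
     (N <= i)%N -> (N <= j)%N -> sqn (u i - u j) < e) ->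
  exists2 f, V f &
    forall e : R, 0 < e -> exists N, forall i, (N <= i)%N -> sqn (u i - f) < e.
Proof.
move=> Vu cu; have [|f Vf uf] := rkhs_complete Vu.
  move=> e e0; have re0 := gt0_of_real e0.
  have [N HN] := cu (complex.Re e ^+ 2) (exprn_gt0 _ re0).
  exists N => i j Ni Nj; rewrite (ge0_of_real (ltW e0)).
  by rewrite (@hnormE (u i - u j))//; [exact: HN|exact: carrierB].
exists f => // e e0.
have s0 : 0 < Num.sqrt e by rewrite sqrtr_gt0.
have s0' : (0 : C) < of_real (Num.sqrt e) by rewrite -of_real0 lt_of_real.
move/cvgrPdist_lt : uf => /(_ _ s0')[N _ HN]; exists N => i Ni.
have := HN i Ni; rewrite sub0r normrN.
rewrite ger0_norm; last first.
  by rewrite sqrtC_ge0 ip_sqn ?le_of_real ?sqn_ge0//; exact: carrierB.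
rewrite (@hnormE (u i - f))//; last exact: carrierB.
by rewrite sqr_sqrtr// ltW.
Qed.

End RealHilbert.

(** * Riesz representation of real functionals on subspaces *)

Section Riesz.
Context {R : realType} {X : Type} {K : X -> X -> cplx R} (H : rkhs K).
Local Notation C := (cplx R).
Local Notation V := (rkhs_carrier H).
Implicit Types f g h : X -> C.

Lemma sqnZ t f : V f -> sqn H (of_real t *: f) = t ^+ 2 * sqn H f.
Proof.
move=> Vf; have Vt := carrierZ (of_real t) Vf.
by rewrite /sqn reipZ// reipC// reipZ// mulrA expr2.
Qed.

Lemma inv_nat_small (e : R) : 0 < e -> exists N, forall k, (N <= k)%N -> k.+1%:R^-1 < e.
Proof.
move=> e0; have /cvgrPdist_lt/(_ _ e0)[N _ HN] := @cvg_harmonic R.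
by exists N => k /HN /=; rewrite sub0r normrN ger0_norm.
Qed.

(* A linear functional on a subspace of [H] is given by its graph [G], which
   makes it available on functions with several representations as linear
   combinations.  The energy [sqn h - 2 * l] is bounded below by hypothesis and
   the minimizing sequences are Cauchy by the parallelogram law. *)
Lemma real_riesz (G : (X -> C) -> R -> Prop) (M : R) :
  G 0 0 ->
  (forall t f l g k, G f l -> G g k -> G (of_real t *: f + g) (t * l + k)) ->
  (forall f l, G f l -> V f) ->
  (forall f l, G f l -> 2 * l <= sqn H f + M) ->
  exists f, [/\ V f, forall h l, G h l -> reip H h f = l, sqn H f <= M
    & forall e, 0 < e -> exists h l, G h l /\ sqn H (h - f) < e].
Proof.
move=> G0 Glin GV GM.
pose J := [set j | exists h l, G h l /\ j = sqn H h - 2 * l].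
have J0 : J !=set0 by exists (sqn H 0 - 2 * 0), 0, 0.
have JM : lbound J (- M) by move=> _ [h [l [Ghl ->]]]; have := GM _ _ Ghl; lra.
have hJ : has_inf J by split=> //; exists (- M).
have Jle h l : G h l -> inf J <= sqn H h - 2 * l.
  by move=> Ghl; apply: ge_inf; [exists (- M)|exists h, l].
have /choice[p pP] : forall k, exists p : (X -> C) * R, G p.1 p.2 /\
    sqn H p.1 - 2 * p.2 < inf J + k.+1%:R^-1.
  move=> k; have k0 : 0 < k.+1%:R^-1 :> R by rewrite invr_gt0.
  by have [_ [h [l [Ghl ->]]] lt] := inf_adherent k0 hJ; exists (h, l).
have Gp k : G (p k).1 (p k).2 by have [] := pP k.
have Vp k : V (p k).1 by exact: GV (Gp k).
have cauchy i j : sqn H ((p i).1 - (p j).1) < 2 * i.+1%:R^-1 + 2 * j.+1%:R^-1.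
  (* The midpoint of the two functions has energy at least [inf J], so the parallelogram law bounds
     their squared distance by twice the sum of the two excess energies. *)
  have Gij := Glin (1 / 2) _ _ _ _ (Glin 1 _ _ _ _ (Gp i) (Gp j)) G0.
  have := Jle _ _ Gij.
  rewrite addr0 scale1r sqnZ; last exact: carrierD.
  rewrite sqn_B// sqn_D//.
  have [_] := pP i; have [_] := pP j.
  move: (i.+1%:R^-1) (j.+1%:R^-1) => ri rj; lra.
have [|f Vf pf] := carrier_complete Vp.
  move=> e e0; have e4 : 0 < e / 4 by lra.
  have [N HN] := inv_nat_small e4; exists N => i j /HN iN /HN jN.
  apply: lt_trans (cauchy i j) _.
  by move: (i.+1%:R^-1) (j.+1%:R^-1) iN jN => ri rj; lra.
have near_f : forall e, 0 < e -> exists k, sqn H ((p k).1 - f) < e /\ k.+1%:R^-1 < e.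
  move=> e e0; have [N1 H1] := inv_nat_small e0; have [N2 H2] := pf _ e0.
  by exists (maxn N1 N2); split; [apply/H2/leq_maxr|apply/H1/leq_maxl].
have Gf h l : G h l -> reip H h f = l.
  move=> Ghl; have Vh := GV _ _ Ghl; have h0 := sqn_ge0 Vh.
  apply/eqP; rewrite -subr_eq0 -sqrf_eq0; apply/eqP/le_anti.
  rewrite sqr_ge0 andbT; apply/ler_addgt0Pr => e e0; rewrite add0r.
  (* The error is a sum [x + y] with [x ^+ 2] and [y ^+ 2] each at most [sqn H h] times a quantity
     below the threshold, and its square is at most [2 * x ^+ 2 + 2 * y ^+ 2]: hence the factor 4.
     The added 1 keeps the denominator positive. *)
  have q0 : 0 < 4 * sqn H h + 1 by lra.
  have e0' : 0 < e / (4 * sqn H h + 1) by rewrite divr_gt0.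
  have [k [kf kN]] := near_f _ e0'.
  have d1 := reip_le Vh (carrierB Vf (Vp k)).
  (* The energy at [of_real t *: h + (p k).1] is a quadratic polynomial in [t] bounded below by
     [inf J]; its discriminant shows that [(p k).1] almost represents the functional. *)
  have d2 : (reip H (p k).1 h - l) ^+ 2 <=
      sqn H h * (sqn H (p k).1 - 2 * (p k).2 - inf J).
    apply: discriminant_le => // t; rewrite (reipC (Vp k) Vh).
    have := Jle _ _ (Glin t _ _ _ _ Ghl (Gp k)); rewrite sqn_lin//. lra.
  have [_ kJ] := pP k.
  move: kf kN; rewrite !ltr_pdivlMr// => kf kN.
  have := reipB Vf (Vp k) Vh; rewrite (reipC _ Vh); last exact: carrierB.
  move=> E; rewrite (reipC Vh Vf).
  have -> : reip H f h - l = reip H h (f - (p k).1) + (reip H (p k).1 h - l).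
    by rewrite E; ring.
  set x := reip H h _ in d1 *; set y := reip H _ h - l in d2 *.
  have xy : (x + y) ^+ 2 <= 2 * x ^+ 2 + 2 * y ^+ 2.
    have -> : 2 * x ^+ 2 + 2 * y ^+ 2 = (x + y) ^+ 2 + (x - y) ^+ 2 by ring.
    by rewrite lerDl sqr_ge0.
  apply: le_trans xy _.
  rewrite sqn_subC// in d1.
  have : y ^+ 2 <= sqn H h * k.+1%:R^-1.
    apply: le_trans d2 _; apply: ler_wpM2l => //.
    by move: (k.+1%:R^-1) kJ => b; lra.
  have := sqn_ge0 (carrierB (Vp k) Vf).
  have : 0 < k.+1%:R^-1 :> R by rewrite invr_gt0.
  move: (k.+1%:R^-1) kN => b; move: kf d1.
  by move: (sqn H (_ - _)) (sqn H h) => a q; lra.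
exists f; split=> //.
(* Since [f] represents the functional, expanding [sqn H ((p k).1 - f)] turns the lower bound [- M]
   on the energy into [sqn H f <= M + e]. *)
- apply/ler_addgt0Pr => e e0; have [k [kf _]] := near_f _ e0.
  have := GM _ _ (Gp k).
  by move: kf; rewrite sqn_B// (Gf _ _ (Gp k)); lra.
- by move=> e /near_f[k [kf _]]; exists (p k).1, (p k).2.
Qed.
End Riesz.

(* Sums along the directed set of finite index sets *)
#[local] Existing Instance totally_filter.

Section Totally.
Context {R : realType} {I : choiceType}.
Local Notation C := (cplx R).
Implicit Types F : {fset I}.

Lemma partial_sumE (Z : zmodType) (x : I -> Z) F :
  partial_sum x F = \sum_(i <- F) x i.
Proof. by rewrite /partial_sum big_seq_fsetE. Qed.

Lemma totally_cvgP (f : {fset I} -> C) (l : C) :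
  (f F @[F --> totally] --> l) <-> forall e : R, 0 < e -> exists F0 : {fset I},
    forall F : {fset I}, (F0 `<=` F)%fset -> `|l - f F| < of_real e.
Proof.
split=> [/cvgrPdist_lt fl e e0|H].
  have e0' : (0 : C) < of_real e by rewrite -of_real0 lt_of_real.
  by have [F0 _ HF] := fl _ e0'; exists F0 => F /HF.
apply/cvgrPdist_lt => e e0; have [F0 HF] := H _ (gt0_of_real e0).
by exists F0 => // F /HF; rewrite -ge0_of_real// ltW.
Qed.

Lemma totally_cvgZ (c : C) (u : {fset I} -> C) (l : C) :
  u F @[F --> totally] --> l -> c * u F @[F --> totally] --> c * l.
Proof.
exact: (@cvgM _ _ _ totally_filter (cst c) _ _ _ (@cvg_cst _ _ _ _ _)).
Qed.

Lemma totally_cvg_sum (T : Type) (s : seq T) (c : T -> C) (u : T -> {fset I} -> C)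
    (l : T -> C) :
  (forall p, u p F @[F --> totally] --> l p) ->
  \sum_(p <- s) c p * u p F @[F --> totally] --> \sum_(p <- s) c p * l p.
Proof.
move=> ul; elim: s => [|p s IH].
  rewrite big_nil; have -> : (fun F => \sum_(p <- [::]) c p * u p F) = cst 0.
    by apply/funext => F; rewrite big_nil.
  exact: cvg_cst.
rewrite big_cons.
have -> : (fun F => \sum_(p <- p :: s) c p * u p F) =
    (fun F => c p * u p F) + (fun F => \sum_(p <- s) c p * u p F).
  by apply/funext => F; rewrite big_cons.
apply: (@cvgD _ _ _ _ totally_filter) IH.
exact: totally_cvgZ.
Qed.

Lemma sum_fset_sub (Z : zmodType) (c : I -> Z) F F' : (F `<=` F')%fset ->
  (forall i, i \in F' -> i \notin F -> c i = 0) ->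
  \sum_(i <- F) c i = \sum_(i <- F') c i.
Proof. by move=> FF' c0; apply: big_fset_incl. Qed.

Lemma eq_sum_fset (Z : zmodType) (c c' : I -> Z) F :
  (forall i, i \in F -> c i = c' i) -> \sum_(i <- F) c i = \sum_(i <- F) c' i.
Proof. by move=> cc'; rewrite big_seq [RHS]big_seq; exact: eq_bigr. Qed.

Lemma ler_sum_fset (Z : numDomainType) (c : I -> Z) F F' : (forall i, 0 <= c i) -> (F `<=` F')%fset ->
  \sum_(i <- F) c i <= \sum_(i <- F') c i.
Proof.
move=> c0 FF'; rewrite (big_fsetID _ (mem F) F') /=.
have -> : [fset x in F' | x \in F]%fset = F.
  apply/fsetP => x; rewrite !inE /=; apply/andP/idP => [[]//|xF].
  by split=> //; exact: (fsubsetP FF').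
by rewrite lerDl sumr_ge0.
Qed.

End Totally.

(** * Squared moduli of complex numbers *)

Section Abs2.
Context {R : realType}.
Local Notation C := (cplx R).
Local Notation Re := (@complex.Re R).
Implicit Types x y : C.

(** The norm of [cplx R] takes its values in [cplx R], which is only partially ordered; this version
    is valued in [R]. *)
Definition abs2 x : R := Re (x * x^*).

Lemma abs2E x : `|x| ^+ 2 = of_real (abs2 x).
Proof. by rewrite normCK; apply: ge0_of_real; rewrite mul_conjC_ge0. Qed.

Lemma abs2_ge0 x : 0 <= abs2 x.
Proof. by rewrite -le_of_real -abs2E exprn_ge0. Qed.

Lemma abs2M x y : abs2 (x * y) = abs2 x * abs2 y.
Proof. by apply: (@complexI R); rewrite rmorphM /= -![(_)%:C%C]abs2E normrM exprMn. Qed.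

Lemma abs2_conj x : abs2 x^* = abs2 x.
Proof. by rewrite /abs2 conjCK mulrC. Qed.

Lemma abs2_of_real t : abs2 (of_real t : C) = t ^+ 2.
Proof. by rewrite /abs2 conj_of_real -of_realM expr2. Qed.

Lemma norm_lt_abs2 x (t : R) : 0 < t -> (`|x| < of_real t) = (abs2 x < t ^+ 2).
Proof.
move=> t0; have t0' : (0 : C) <= of_real t by rewrite -of_real0 le_of_real ltW.
by rewrite -(@ltr_pXn2r _ 2) ?nnegrE// abs2E -of_realX lt_of_real.
Qed.

Lemma Re_conjM_le x y : 2 * Re (x^* * y) <= abs2 x + abs2 y.
Proof.
have := abs2_ge0 (x - y); rewrite /abs2; case: x y => [a b] [c d] /=; lra.
Qed.

End Abs2.

(** * Hilbert spaces whose kernel expands in a family of functions *)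

Section KernelExpansion.
Context {R : realType} {X : Type} {K : X -> X -> cplx R} (H : rkhs K).
Context {I : choiceType} (e : I -> X -> cplx R).
Local Notation C := (cplx R).
Local Notation V := (rkhs_carrier H).
Local Notation Re := (@complex.Re R).
Implicit Types (f g h : X -> C) (F : {fset I}) (s : seq (C * X)).

(** The two properties of [e] on which the abstract argument rests; [triangle_kernelE] and
    [basis_fun_indep] establish them for the triangle. *)
Hypothesis kernelE : forall z w,
  partial_sum (fun a => e a z * (e a w)^* ) F @[F --> totally] --> K z w.
Hypothesis e_indep : forall D : I -> C,
  (forall z, partial_sum (fun a => D a * e a z) F @[F --> totally] --> (0 : C)) ->
  forall a, D a = 0.

(** Multiplying [f] by the conjugate of [c] makes its product with [g] equal to the real number
    [abs2 c]. The real Cauchy-Schwarz inequality then applies, and one factor [abs2 c] cancels. *)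
Lemma ip_abs2_le f g : V f -> V g -> abs2 (ip H f g) <= sqn H f * sqn H g.
Proof.
move=> Vf Vg; set c := ip H f g.
have Vcf := carrierZ c^* Vf.
have := reip_le Vcf Vg.
rewrite /reip ipZ// -/c mulrC -/(abs2 c).
have -> : sqn H (c^* *: f) = abs2 c * sqn H f.
  rewrite /sqn /reip ipZ// ipZr// conjCK mulrA [c^* * c]mulrC -normCK abs2E.
  by rewrite Re_realM.
have := abs2_ge0 c; rewrite le_eqVlt => /predU1P[<- _|c0].
  by rewrite mulr_ge0 ?sqn_ge0.
by rewrite expr2 -mulrA ler_pM2l.
Qed.

Definition kcomb s : X -> C := \sum_(p <- s) p.1 *: K ^~ p.2.
(** The number v_a of the sketch: the coefficient of [e a] in the pointwise expansion of
    [kcomb s]. *)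
Definition kcoef s (a : I) : C := \sum_(p <- s) p.1 * (e a p.2)^*.

Lemma sum_app (J : Type) (r : seq J) (G : J -> X -> C) x :
  (\sum_(i <- r) G i) x = \sum_(i <- r) G i x.
Proof. by elim/big_ind2: _ => // f a g b <- <-. Qed.

Lemma kcombE s z : kcomb s z = \sum_(p <- s) p.1 * K z p.2.
Proof. by rewrite /kcomb sum_app. Qed.

Lemma carrier_kcomb s : V (kcomb s).
Proof. by apply: carrier_sum => p; apply/carrierZ/rkhs_kernel. Qed.

Lemma kcomb_cvg s z :
  partial_sum (fun a => kcoef s a * e a z) F @[F --> totally] --> kcomb s z.
Proof.
have -> : (fun F => partial_sum (fun a => kcoef s a * e a z) F) =
    (fun F => \sum_(p <- s) p.1 * partial_sum (fun a => e a z * (e a p.2)^* ) F).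
  apply/funext => F; rewrite partial_sumE.
  under [RHS]eq_bigr do rewrite partial_sumE mulr_sumr.
  rewrite exchange_big /=; apply: eq_bigr => a _.
  by rewrite mulr_suml; apply: eq_bigr => p _; rewrite mulrAC -mulrA.
rewrite kcombE.
have := @totally_cvg_sum R I _ s (fun p => p.1)
  (fun p F => partial_sum (fun a => e a z * (e a p.2)^* ) F) (fun p => K z p.2).
by apply => p; exact: kernelE.
Qed.

(** Parseval's identity for kernel combinations: the reproducing property writes the squared norm
    through values of [kcomb s], and [kcomb_cvg] expands each of them. *)
Lemma sqn_kcomb s :
  partial_sum (fun a => of_real (abs2 (kcoef s a))) F @[F --> totally] -->
    (ip H (kcomb s) (kcomb s))^*.
Proof.
have -> : (ip H (kcomb s) (kcomb s))^* = \sum_(p <- s) (p.1)^* * kcomb s p.2.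
  have Vk := carrier_kcomb s.
  rewrite -ip_conj// {2}/kcomb ip_sumr//; last by move=> p; apply/carrierZ/rkhs_kernel.
  apply: eq_bigr => p _; have Vp := rkhs_kernel H p.2.
  by rewrite ipZr// -rkhs_reproducing.
have -> : (fun F => partial_sum (fun a => of_real (abs2 (kcoef s a))) F) =
    (fun F => \sum_(p <- s) (p.1)^* * partial_sum (fun a => kcoef s a * e a p.2) F).
  apply/funext => F; rewrite partial_sumE.
  under [RHS]eq_bigr do rewrite partial_sumE mulr_sumr.
  rewrite exchange_big /=; apply: eq_bigr => a _.
  rewrite -abs2E normCK {2}/kcoef rmorph_sum mulr_sumr.
  by apply: eq_bigr => p _; rewrite rmorphM /= conjCK mulrCA.
have := @totally_cvg_sum R I _ s (fun p => p.1^* )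
  (fun p F => partial_sum (fun a => kcoef s a * e a p.2) F) (fun p => kcomb s p.2).
by apply => p; exact: kcomb_cvg.
Qed.

Lemma kcoef_le s F : \sum_(a <- F) abs2 (kcoef s a) <= sqn H (kcomb s).
Proof.
apply/ler_addgt0Pr => d d0.
have /totally_cvgP/(_ _ d0)[F0 HF] := @sqn_kcomb s.
have := HF (F0 `|` F)%fset (fsubsetUl _ _).
rewrite partial_sumE ip_sqn; last exact: carrier_kcomb.
rewrite conj_of_real /of_real -rmorph_sum -rmorphB norm_lt_abs2// abs2_of_real.
rewrite -[X in X < _]real_normK ?num_real// ltr_pXn2r ?nnegrE// ?(ltW d0)// => h.
have := ler_sum_fset (fun a => abs2_ge0 (kcoef s a)) (fsubsetUr F0 F).
move: h; rewrite ltr_norml => /andP[]; lra.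
Qed.

(** The functional that pairs the conjugates of [c] with [kcoef s] is bounded on kernel combinations
    by [kcoef_le]. Its Riesz representative agrees with the finite combination at every point, which
    is how the latter is seen to lie in the carrier. *)
Lemma ecomb_carrier F (c : I -> C) :
  V (\sum_(a <- F) c a *: e a) /\
  sqn H (\sum_(a <- F) c a *: e a) <= \sum_(a <- F) abs2 (c a).
Proof.
set f := \sum_(a <- F) c a *: e a.
have fE z : f z = \sum_(a <- F) c a * e a z by rewrite /f sum_app.
(* The functional is written through the values of [f], since [f] is not yet known to lie in the
   carrier. *)
pose G h (l : R) := exists s, h = kcomb s /\ l = Re (\sum_(p <- s) p.1 * (f p.2)^* ).
have [||||g [Vg Gg gM _]] := @real_riesz R X K H G (\sum_(a <- F) abs2 (c a)).
- by exists [::]; rewrite /kcomb !big_nil.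
- move=> t h l h' l' [s [-> ->]] [s' [-> ->]].
  exists ([seq (of_real t * p.1, p.2) | p <- s] ++ s'); split.
    rewrite /kcomb big_cat big_map scaler_sumr /=; congr (_ + _).
    by apply: eq_bigr => p _; rewrite scalerA.
  rewrite big_cat big_map ReD -Re_realM mulr_sumr /=; congr (Re _ + _).
  by apply: eq_bigr => p _; rewrite mulrA.
- by move=> h l [s [-> _]]; exact: carrier_kcomb.
- move=> h l [s [-> ->]].
  have -> : \sum_(p <- s) p.1 * (f p.2)^* = \sum_(a <- F) (c a)^* * kcoef s a.
    under eq_bigr do rewrite fE rmorph_sum mulr_sumr.
    rewrite exchange_big /=; apply: eq_bigr => a _.
    by rewrite mulr_sumr; apply: eq_bigr => p _; rewrite rmorphM /= mulrCA.
  apply: le_trans (lerD (kcoef_le s F) (lexx _)).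
  rewrite addrC -big_split /= Re_sum mulr_sumr.
  by apply: ler_sum => a _; exact: Re_conjM_le.
suff -> : f = g by [].
apply/funext => w; rewrite (rkhs_reproducing w Vg).
have Vw := rkhs_kernel H w.
(* Testing on all complex multiples of one kernel function recovers the complex value from real
   parts. *)
rewrite (ip_conj Vw Vg); apply/esym/(canLR (@conjCK _))/eq_Re_scale => a.
have := Gg (a *: K ^~ w) (Re (a * (f w)^* )).
rewrite /reip ipZ//; apply.
by exists [:: (a, w)]; rewrite /kcomb !big_seq1.
Qed.

Lemma e_carrier a : V (e a).
Proof.
have [] := ecomb_carrier [fset a]%fset (fun=> 1).
by rewrite big_seq_fset1 scale1r.
Qed.

Lemma ip_kernel f w : V f -> ip H (K ^~ w) f = (f w)^*.
Proof. by move=> Vf; rewrite (ip_conj Vf (rkhs_kernel H w)) -rkhs_reproducing. Qed.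

Definition kernel_rest w F : X -> C :=
  K ^~ w - \sum_(a <- F) (e a w)^* *: e a.

(** In the expanded square the cross term contributes minus twice the sum of the [abs2 (e a w)],
    while [ecomb_carrier] bounds the last term by that sum once. An inequality is all that is
    available before orthonormality. *)
Lemma kernel_rest_le w F :
  sqn H (kernel_rest w F) <= Re (K w w) - \sum_(a <- F) abs2 (e a w).
Proof.
have [VS SS] := ecomb_carrier F (fun a => (e a w)^* ).
have Vw := rkhs_kernel H w.
rewrite /kernel_rest sqn_B// /reip ip_kernel// Re_conj sum_app Re_sum.
have -> : sqn H (K ^~ w) = Re (K w w) by rewrite /sqn /reip -rkhs_reproducing.
have -> : \sum_(a <- F) Re (((e a w)^* *: e a) w) = \sum_(a <- F) abs2 (e a w).
  by apply: eq_bigr => a _; rewrite /abs2 mulrC.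
move: SS; under [X in _ <= X]eq_bigr do rewrite abs2_conj.
lra.
Qed.

Lemma diag_cvg w (d : R) : 0 < d -> exists F0 : {fset I}, forall F, (F0 `<=` F)%fset ->
  Re (K w w) - \sum_(a <- F) abs2 (e a w) < d.
Proof.
move=> d0; have /totally_cvgP/(_ _ d0)[F0 HF] := @kernelE w w.
exists F0 => F /HF; rewrite partial_sumE.
under eq_bigr do rewrite -normCK abs2E.
have -> : K w w = of_real (Re (K w w)).
  have := rkhs_reproducing w (rkhs_kernel H w); rewrite ip_sqn; last exact: rkhs_kernel.
  by move=> /= ->.
rewrite /of_real -rmorph_sum -rmorphB norm_lt_abs2// abs2_of_real.
rewrite -[X in X < _]real_normK ?num_real// ltr_pXn2r ?nnegrE// ?(ltW d0)//.
by rewrite ltr_norml => /andP[].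
Qed.

(** The truncation error at [w] is the inner product of [f] with [kernel_rest w F], so
    Cauchy-Schwarz applies. *)
Lemma expansion_err f w F : V f ->
  abs2 (f w - \sum_(a <- F) ip H f (e a) * e a w) <=
  sqn H f * (Re (K w w) - \sum_(a <- F) abs2 (e a w)).
Proof.
move=> Vf; have Vw := rkhs_kernel H w.
have Ve a : V ((e a w)^* *: e a) by apply: carrierZ; exact: e_carrier.
have [VS _] := ecomb_carrier F (fun a => (e a w)^* ).
have Vr : V (kernel_rest w F) by exact: carrierB.
have -> : f w - \sum_(a <- F) ip H f (e a) * e a w = ip H f (kernel_rest w F).
  rewrite (ip_conj Vr Vf) ipB// rmorphB /= ip_kernel// conjCK.
  congr (_ - _); rewrite -(ip_conj VS Vf) ip_sumr//; apply: eq_bigr => a _.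
  by rewrite (ipZr _ Vf (e_carrier a)) conjCK mulrC.
apply: le_trans (ip_abs2_le Vf Vr) _.
by rewrite ler_wpM2l ?sqn_ge0// kernel_rest_le.
Qed.

Lemma expansion_cvg f w : V f ->
  partial_sum (fun a => ip H f (e a) * e a w) F @[F --> totally] --> f w.
Proof.
move=> Vf; apply/totally_cvgP => d d0.
(* The added 1 covers [f = 0]. *)
have q0 : 0 < sqn H f + 1 by rewrite ltr_wpDl ?sqn_ge0.
have d1 : 0 < d ^+ 2 / (sqn H f + 1) by rewrite divr_gt0 ?exprn_gt0.
have [F0 HF] := diag_cvg w d1; exists F0 => F /HF h.
rewrite norm_lt_abs2// partial_sumE.
apply: le_lt_trans (expansion_err w F Vf) _.
move: h; rewrite ltr_pdivlMr// mulrC; apply: le_lt_trans.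
rewrite ler_wpM2r ?lerDl//.
have [VS _] := ecomb_carrier F (fun a => (e a w)^* ).
have Vr : V (kernel_rest w F) := carrierB (rkhs_kernel H w) VS.
exact: le_trans (sqn_ge0 Vr) (kernel_rest_le w F).
Qed.

(** Expanding [e a] by [expansion_cvg] gives a second series for [e a], next to the one with the
    single term [e a]; [e_indep] identifies their coefficients. *)
Lemma e_orthonormal a b : ip H (e a) (e b) = (a == b)%:R.
Proof.
apply/eqP; rewrite -subr_eq0; apply/eqP.
apply: (e_indep (D := fun b => ip H (e a) (e b) - (a == b)%:R)) => z.
apply/totally_cvgP => d d0.
have /totally_cvgP/(_ _ d0)[F0 HF] := @expansion_cvg _ z (e_carrier a).
exists (F0 `|` [fset a])%fset => F; rewrite fsubUset => /andP[/HF + aF].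
rewrite !partial_sumE => h; apply: le_lt_trans h.
under [X in `|0 - X| <= _]eq_bigr do rewrite mulrBl.
rewrite sumrB /= sub0r normrN distrC.
rewrite (_ : \sum_(i <- F) (a == i)%:R * e i z = e a z)//.
rewrite -(sum_fset_sub aF) ?big_seq_fset1 ?eqxx ?mul1r// => i _.
by rewrite inE eq_sym => /negPf ->; rewrite mul0r.
Qed.

Definition ecomb F (c : I -> C) : X -> C := \sum_(a <- F) c a *: e a.
Definition proj f F : X -> C := ecomb F (fun a => ip H f (e a)).

Lemma ecombV F c : V (ecomb F c).
Proof. by have [] := ecomb_carrier F c. Qed.

Lemma lin_spanE g : lin_span e g <-> exists F c, g = ecomb F c.
Proof.
by split=> -[F [c ->]]; exists F, c; rewrite partial_sumE.
Qed.

Lemma ecombD F c F' c' : exists F2 c2, ecomb F c + ecomb F' c' = ecomb F2 c2.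
Proof.
exists (F `|` F')%fset,
  (fun a => (if a \in F then c a else 0) + (if a \in F' then c' a else 0)).
rewrite /ecomb; under [RHS]eq_bigr do rewrite scalerDl.
rewrite big_split /=; congr (_ + _).
- rewrite -[RHS](@sum_fset_sub _ _ _ F) ?fsubsetUl//.
    by apply: eq_sum_fset => a ->.
  by move=> a _ /negPf ->; rewrite scale0r.
- rewrite -[RHS](@sum_fset_sub _ _ _ F') ?fsubsetUr//.
    by apply: eq_sum_fset => a ->.
  by move=> a _ /negPf ->; rewrite scale0r.
Qed.

(** Riesz, applied to [h |-> reip H h f] on the finite combinations, yields a limit [g] of such
    combinations. It has the same coefficients as [f], and [expansion_cvg] then gives [f = g]
    pointwise. *)
Lemma e_approx f (d : R) : V f -> 0 < d ->
  exists F c, sqn H (f - ecomb F c) < d.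
Proof.
move=> Vf d0.
pose G h (l : R) := exists F c, h = ecomb F c /\ l = reip H h f.
have [||||g [Vg Gg _ appr]] := @real_riesz R X K H G (sqn H f).
- exists fset0, (fun=> 0); rewrite /ecomb big_seq_fset0; split=> //.
  by rewrite /reip ip0l.
- move=> t h l h' l' [F [c [-> ->]]] [F' [c' [-> ->]]].
  have tE : of_real t *: ecomb F c = ecomb F (fun a => of_real t * c a).
    by rewrite /ecomb scaler_sumr; apply: eq_bigr => a _; rewrite scalerA.
  have VF := ecombV F c.
  rewrite -reipZ// -reipD//; try exact: ecombV; last exact: carrierZ.
  by rewrite tE; have [F2 [c2 E]] := ecombD F (fun a => of_real t * c a) F' c'; exists F2, c2.
- by move=> h l [F [c [-> _]]]; exact: ecombV.
- move=> h l [F [c [-> ->]]].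
  have := sqn_ge0 (carrierB (ecombV F c) Vf); rewrite sqn_B//; last exact: ecombV.
  lra.
have eg a : ip H g (e a) = ip H f (e a).
  have Ve := e_carrier a.
  rewrite (ip_conj Ve Vg) (ip_conj Ve Vf); congr (_^* ).
  apply: eq_Re_scale => t.
  have := Gg (t *: e a) (reip H (t *: e a) f).
  rewrite /reip !ipZ//; apply; exists [fset a]%fset, (fun=> t).
  by rewrite /ecomb big_seq_fset1 /reip -ipZ.
have -> : f = g.
  apply/funext => z; have fz := @expansion_cvg _ z Vf; have := @expansion_cvg _ z Vg.
  have -> : (fun a => ip H g (e a) * e a z) = (fun a => ip H f (e a) * e a z).
    by apply/funext => a; rewrite eg.
  by move=> gz; apply: (cvg_unique _ fz gz).
have [h [l [[F [c [-> _]]] hg]]] := appr d d0.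
by exists F, c; rewrite sqn_subC//; exact: ecombV.
Qed.

(** Pythagoras: [f - proj f F'] is orthogonal to every [e a] with [a] in [F'], and
    [proj f F' - ecomb F c] is a combination of these. *)
Lemma proj_best f F F' c : V f -> (F `<=` F')%fset ->
  sqn H (f - proj f F') <= sqn H (f - ecomb F c).
Proof.
move=> Vf FF'.
pose c' a := ip H f (e a) - (if a \in F then c a else 0).
have cE : ecomb F c = ecomb F' (fun a => if a \in F then c a else 0).
  rewrite /ecomb -[RHS](@sum_fset_sub _ _ _ F)//.
    by apply: eq_sum_fset => a ->.
  by move=> a _ /negPf ->; rewrite scale0r.
have VP := ecombV F' (fun a => ip H f (e a)).
have Vc := ecombV F c; have Vc' := ecombV F' c'.
have -> : f - ecomb F c = (f - proj f F') + ecomb F' c'.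
  rewrite -addrA; congr (_ + _); rewrite cE.
  set d := ecomb F' _; suff -> : proj f F' = ecomb F' c' + d by rewrite opprD addrAC addNr add0r.
  rewrite /proj /d /ecomb -big_split /=; apply: eq_bigr => a _.
  by rewrite -scalerDl /c' subrK.
have Vr : V (f - proj f F') by exact: carrierB.
rewrite (sqn_D Vr Vc').
suff -> : reip H (f - proj f F') (ecomb F' c') = 0.
  by rewrite mulr0 addr0 lerDl sqn_ge0.
have orth a : a \in F' -> ip H (f - proj f F') (e a) = 0.
  move=> aF'; have Ve := e_carrier a.
  rewrite ipB// /proj /ecomb ip_sum//; last by move=> i; apply/carrierZ/e_carrier.
  rewrite (big_fsetD1 a)//= big1_fset ?addr0.
    by rewrite ipZ// e_orthonormal eqxx mulr1 subrr.
  move=> i; rewrite !inE => /andP[ia _] _; rewrite ipZ//; last exact: e_carrier.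
  by rewrite e_orthonormal (negPf ia) mulr0.
rewrite /reip /ecomb ip_sumr//; last by move=> i; apply/carrierZ/e_carrier.
rewrite big1_fset// => a aF' _.
by rewrite ipZr ?orth ?mulr0//; exact: e_carrier.
Qed.

Lemma proj_cvg f (d : R) : V f -> 0 < d ->
  exists F0 : {fset I}, forall F, (F0 `<=` F)%fset -> sqn H (f - proj f F) < d.
Proof.
move=> Vf /(e_approx Vf)[F0 [c hd]]; exists F0 => F FF.
exact: le_lt_trans (proj_best c Vf FF) hd.
Qed.

Lemma proj_pointwise f F z : V f ->
  abs2 (f z - proj f F z) <= sqn H (f - proj f F) * Re (K z z).
Proof.
move=> Vf; have VP : V (f - proj f F) by apply/carrierB/ecombV.
have -> : f z - proj f F z = (f - proj f F) z by [].
rewrite (rkhs_reproducing z VP).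
apply: le_trans (ip_abs2_le VP (rkhs_kernel H z)) _.
by rewrite {2}/sqn /reip -rkhs_reproducing//; exact: rkhs_kernel.
Qed.

Lemma e_orthonormal_basis : orthonormal_basis H e.
Proof.
split; [exact: e_carrier|exact: e_orthonormal|split].
  by move=> g /lin_spanE[F [c ->]]; exact: ecombV.
move=> f Vf d d0; have d0' := gt0_of_real d0.
have [F [c hd]] := e_approx Vf (exprn_gt0 2 d0').
exists (ecomb F c); first by apply/lin_spanE; exists F, c.
by rewrite (ge0_of_real (ltW d0)) hnormE//; apply/carrierB/ecombV.
Qed.

End KernelExpansion.

(** * Uniqueness of the coefficients of a multiple power series *)

Lemma base_repr_inj (B n : nat) (a b : 'I_n -> nat) :
  (forall j, (a j < B)%N) -> (forall j, (b j < B)%N) ->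
  (\sum_j a j * B ^ j = \sum_j b j * B ^ j)%N -> a =1 b.
Proof.
elim: n a b => [|n IH] a b aB bB; first by move=> _ [].
have split_sum (c : 'I_n.+1 -> nat) :
    (\sum_j c j * B ^ j = (\sum_(j < n) c (lift ord0 j) * B ^ j) * B + c ord0)%N.
  rewrite big_ord_recl expn0 muln1 addnC; congr (_ + _)%N.
  by rewrite big_distrl /=; apply: eq_bigr => j _; rewrite /bump add1n expnSr mulnA.
rewrite !split_sum => E.
(* Quotient and remainder by [B] separate the lowest digit from the others. *)
have /andP[/eqP E1 /eqP E0] : ((\sum_(j < n) a (lift ord0 j) * B ^ j ==
    \sum_(j < n) b (lift ord0 j) * B ^ j) && (a ord0 == b ord0))%N.
  have B0 : (0 < B)%N by exact: leq_ltn_trans (leq0n _) (aB ord0).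
  have := congr1 (fun k => k %/ B)%N E; have := congr1 (fun k => k %% B)%N E.
  by rewrite /= !modnMDl !divnMDl// !modn_small// !divn_small// !addn0 => -> ->; rewrite !eqxx.
move=> j; case: (unliftP ord0 j) => [k ->|->//].
by apply: (IH (fun i => a (lift ord0 i)) (fun i => b (lift ord0 i))).
Qed.

(** Any finite set [F] is the union of [F0] and [F] with the part of [F0] outside [F] removed, so
    all finite sums of [u] are uniformly bounded. Splitting [F] by the sign of [u] carries the bound
    over to absolute values. *)
Lemma totally_bounded (R : realType) (I : choiceType) (u : I -> R) :
  (forall e, 0 < e -> exists F0 : {fset I}, forall F : {fset I},
     (F0 `<=` F)%fset -> `|\sum_(i <- F) u i| < e) ->
  exists B, forall F : {fset I}, \sum_(i <- F) `|u i| <= B.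
Proof.
move=> /(_ 1 ltr01)[F0 HF]; pose b := \sum_(i <- F0) `|u i|.
have bound (F : {fset I}) : `|\sum_(i <- F) u i| <= 1 + b.
  have -> : \sum_(i <- F) u i =
      \sum_(i <- (F0 `|` F)%fset) u i - \sum_(i <- (F0 `\` F)%fset) u i.
    rewrite (big_fsetID _ (mem F) (F0 `|` F)%fset) /=.
    have -> : [fset x in (F0 `|` F)%fset | x \in F]%fset = F.
      by apply/fsetP => x; rewrite !inE /= andb_orl andbb orbC orb_idr// => /andP[].
    have -> : [fset x in (F0 `|` F)%fset | x \notin F]%fset = (F0 `\` F)%fset.
      by apply/fsetP => x; rewrite !inE /=; case: (x \in F); rewrite ?orbF ?andbT ?andbF.
    by rewrite addrK.
  apply: le_trans (ler_normB _ _) _; apply: lerD.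
    exact/ltW/HF/fsubsetUl.
  apply: le_trans (ler_norm_sum _ _ _) _.
  by apply: ler_sum_fset => //; exact: fsubsetDl.
exists ((1 + b) + (1 + b)) => F.
rewrite (big_fsetID _ (fun i => 0 <= u i) F) /=.
apply: lerD.
  apply: le_trans (bound [fset i in F | 0 <= u i]%fset).
  rewrite (eq_sum_fset (c' := u)) ?ler_norm// => i; rewrite !inE /= => /andP[_ ?].
  exact: ger0_norm.
apply: le_trans (bound [fset i in F | ~~ (0 <= u i)]%fset).
rewrite -normrN -sumrN (eq_sum_fset (c' := fun i => - u i)) ?ler_norm// => i.
rewrite !inE /= -ltNge => /andP[_ ?]; exact: ltr0_norm.
Qed.

(** On a curve [x j = t ^+ w j] the monomials become powers of [t]. With weights that single out one
    nonzero term of least weight, this term dominates all others for small [t], so the sums cannot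
    tend to 0. *)
Lemma power_series_unique_real (R : realType) (n : nat) (D : multinom n -> R) (r : R) :
  0 < r ->
  (forall x : 'I_n -> R, (forall j, 0 < x j < r) ->
    forall e, 0 < e -> exists F0 : {fset multinom n}, forall F : {fset multinom n},
     (F0 `<=` F)%fset -> `|\sum_(a <- F) D a * \prod_j x j ^+ a j| < e) ->
  forall a, D a = 0.
Proof.
move=> r0 Dx a0; apply/eqP; apply/negP => /negP Da0.
have /ex_minnP[d /asboolP[a1 [Da1 a1d]] dmin] :
    exists k, `[< exists a, D a != 0 /\ mdeg a = k >].
  by exists (mdeg a0); apply/asboolP; exists a0.
have {}dmin a : D a != 0 -> (d <= mdeg a)%N.
  by move=> Da; apply: dmin; apply/asboolP; exists a.
(* Weights separating the exponents: the common part makes the total degree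
   dominant, and the powers of [d.+1] separate the exponents of degree [d]. *)
pose M := (d * d.+1 ^ n).+1.
pose w (j : 'I_n) := (M + d.+1 ^ j)%N.
pose wt (a : multinom n) := (\sum_j a j * w j)%N.
have wtE a : wt a = (mdeg a * M + \sum_j a j * d.+1 ^ j)%N.
  rewrite mdegE big_distrl -big_split /=.
  by apply: eq_bigr => j _; rewrite /w mulnDr.
have /ex_minnP[k /asboolP[a [Da ak]] kmin] :
    exists k, `[< exists a, D a != 0 /\ wt a = k >].
  by exists (wt a0); apply/asboolP; exists a0.
have {}kmin b : D b != 0 -> (wt a <= wt b)%N.
  by move=> Db; rewrite ak; apply: kmin; apply/asboolP; exists b.
have degd b : D b != 0 -> (wt b <= wt a)%N -> mdeg b = d.
  move=> Db ba; apply/eqP; rewrite eqn_leq dmin// andbT leqNgt; apply/negP => db.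
  have := leq_trans ba (kmin _ Da1); rewrite leqNgt => /negP; apply.
  (* [M] exceeds the sum of the [a1 j * d.+1 ^ j], because [a1] has degree [d] and every [j] is
     below [n]. *)
  rewrite !wtE a1d; apply: (@leq_trans (d.+1 * M)%N).
    rewrite mulSn addnC ltn_add2r /M ltnS.
    rewrite -a1d mdegE big_distrl /=; apply: leq_sum => j _.
    by rewrite leq_mul2l leq_pexp2l ?orbT// ltnW.
  by apply: leq_trans (leq_addr _ _); rewrite leq_mul2r db orbT.
have wt_lt b : D b != 0 -> b != a -> (wt a < wt b)%N.
  move=> Db /eqP ba; rewrite ltn_neqAle kmin// andbT; apply/negP => /eqP wab.
  apply: ba; apply/mnmP.
  have da := degd _ Da (leqnn _).
  have db : mdeg b = d by apply: degd => //; rewrite wab.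
  have le_deg c : mdeg c = d -> forall j, (c j < d.+1)%N.
    move=> <- j; rewrite ltnS mdegE (bigD1 j)//=; exact: leq_addr.
  apply: (@base_repr_inj d.+1); [exact: le_deg|exact: le_deg|].
  move: wab; rewrite !wtE da db => /eqP; rewrite eqn_add2l => /eqP ->//.
pose x (t : R) (j : 'I_n) := t ^+ w j.
have xE t (b : multinom n) : \prod_j x t j ^+ b j = t ^+ wt b.
  rewrite /wt (big_morph _ (exprD t) (expr0 t)).
  by apply: eq_bigr => j _; rewrite /x -exprM mulnC.
pose t0 : R := Num.min r 1 / 2.
have m0 : 0 < Num.min r 1 by rewrite lt_min r0 ltr01.
have t00 : 0 < t0 by rewrite divr_gt0.
have min_r : Num.min r 1 <= r by rewrite ge_min lexx.
have min_1 : Num.min r 1 <= 1 by rewrite ge_min lexx orbT.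
have t0r : t0 < r by rewrite /t0; lra.
have t01 : t0 < 1 by rewrite /t0; lra.
have xr t j : 0 < t <= t0 -> 0 < x t j < r.
  move=> /andP[t_gt0 tt0]; rewrite exprn_gt0//= (le_lt_trans _ t0r)//.
  apply: le_trans (tt0); rewrite -[X in _ <= X]expr1.
  by apply: ler_wiXn2l => //; [exact: ltW|exact: ltW (le_lt_trans tt0 t01)].
have t0t : 0 < t0 <= t0 by rewrite t00 lexx.
have [B HB] := totally_bounded (Dx (x t0) (fun j => xr _ j t0t)).
have {}HB (F : {fset multinom n}) : \sum_(b <- F) `|D b| * t0 ^+ wt b <= B.
  apply: le_trans (HB F); apply: ler_sum => b _.
  by rewrite xE normrM (ger0_norm (exprn_ge0 _ (ltW t00))).
pose c := `|D a| * t0 ^+ wt a.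
have c0 : 0 < c by rewrite mulr_gt0 ?normr_gt0 ?exprn_gt0.
have B0 : 0 <= B by have := HB fset0; rewrite big_seq_fset0.
have cB0 : 0 < c + B + 1 by lra.
(* This choice gives [s * B < c]: at [s * t0] the leading term has size [s ^+ wt a * c], whereas all
   others together have size at most [s ^+ (wt a).+1 * B]. *)
pose s := c / (c + B + 1).
have s0 : 0 < s by rewrite divr_gt0.
have s1 : s < 1 by rewrite ltr_pdivrMr// mul1r; lra.
have csB : 0 < c - s * B.
  rewrite subr_gt0 /s mulrAC ltr_pdivrMr// ltr_pM2l//; lra.
have st0 : 0 < s * t0 <= t0 by rewrite mulr_gt0//= ger_pMl// ltW.
have st_ge0 : 0 <= s * t0 by rewrite mulr_ge0// ltW.
have e0 : 0 < s ^+ wt a * (c - s * B) by rewrite mulr_gt0 ?exprn_gt0.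
have [F0 /(_ (a |` F0)%fset (fsubsetU1 _ _))] := Dx _ (fun j => xr _ j st0) _ e0.
have aF : a \in (a |` F0)%fset by rewrite !inE eqxx.
move: (a |` F0)%fset aF => F aF.
rewrite (big_fsetD1 a)//= xE.
set rest := \sum_(i <- _) _ => lt_e.
have rest_le : `|rest| <= s ^+ (wt a).+1 * B.
  apply: le_trans (ler_norm_sum _ _ _) _.
  apply: (@le_trans _ _ (s ^+ (wt a).+1 * \sum_(b <- (F `\ a)%fset) `|D b| * t0 ^+ wt b)).
    rewrite mulr_sumr big_seq [X in _ <= X]big_seq; apply: ler_sum => b.
    rewrite !inE => /andP[ba _]; rewrite xE normrM.
    have [->|Db] := eqVneq (D b) 0; first by rewrite normr0 !mul0r mulr0.
    rewrite (ger0_norm (exprn_ge0 _ st_ge0)) exprMn mulrCA.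
    rewrite ler_wpM2r ?mulr_ge0 ?exprn_ge0 ?(ltW t00)//.
    by apply: ler_wiXn2l; rewrite ?ltW//; exact: wt_lt.
  by rewrite ler_wpM2l ?HB ?exprn_ge0 ?(ltW s0).
have : `|D a * (s * t0) ^+ wt a| = s ^+ wt a * c.
  rewrite normrM (ger0_norm (exprn_ge0 _ st_ge0)) exprMn mulrCA.
  by [].
have := ler_normB (D a * (s * t0) ^+ wt a + rest) rest; rewrite addrK.
move: lt_e rest_le; rewrite exprS mulrBr.
move: (`|_ + rest|) (`|rest|) (`|_ * _|) => p q o; lra.
Qed.

(** At real points the monomials are real, so the real case applies to the coefficients
    [Re (c * D a)] for each complex [c]. *)
Lemma power_series_unique (R : realType) (n : nat) (D : multinom n -> cplx R) (r : R) :
  0 < r ->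
  (forall x : 'rV[R]_n, (forall j, 0 < x 0 j < r) ->
    partial_sum (fun a => D a * monomial (map_mx (@of_real R) x) a) F
      @[F --> totally] --> (0 : cplx R)) ->
  forall a, D a = 0.
Proof.
move=> r0 Dx.
have monE (x : 'rV[R]_n) a : monomial (map_mx (@of_real R) x) a =
    of_real (\prod_j x 0 j ^+ a j).
  rewrite /monomial /of_real rmorph_prod; apply: eq_bigr => j _.
  by rewrite mxE rmorphXn.
have ReD0 (c : cplx R) a : complex.Re (c * D a) = 0.
  apply: (power_series_unique_real (D := fun a => complex.Re (c * D a)) r0) => x xr e e0.
  have xr' j : 0 < (\row_j x j) 0 j < r by rewrite mxE.
  have q0 : 0 < abs2 c + 1 by rewrite ltr_wpDl ?abs2_ge0.
  (* Chosen so that a sum of modulus below [e1] stays below [e] after multiplication by [c]. *)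
  pose e1 := Num.sqrt (e ^+ 2 / (abs2 c + 1)).
  have e10 : 0 < e1 by rewrite sqrtr_gt0 divr_gt0 ?exprn_gt0.
  have /totally_cvgP/(_ _ e10)[F0 HF] := Dx _ xr'.
  exists F0 => F /HF; rewrite sub0r normrN partial_sumE norm_lt_abs2// sqr_sqrtr; last first.
    by rewrite divr_ge0 ?exprn_ge0 ?ltW.
  set S := \sum_(i <- F) _ => S_lt.
  have -> : \sum_(i <- F) complex.Re (c * D i) * \prod_j x j ^+ i j = complex.Re (c * S).
    rewrite mulr_sumr Re_sum; apply: eq_bigr => i _.
    rewrite monE mulrA [in RHS]mulrC Re_realM mulrC; congr (_ * _).
    by apply: eq_bigr => j _; rewrite mxE.
  have Re_le (y : cplx R) : (complex.Re y) ^+ 2 <= abs2 y.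
    by case: y => p q; rewrite /abs2 /=; have := sqr_ge0 q; lra.
  rewrite -(@ltr_pXn2r _ 2) ?nnegrE ?(ltW e0)// real_normK ?num_real//.
  apply: le_lt_trans (Re_le _) _; rewrite abs2M.
  move: S_lt; rewrite ltr_pdivlMr// mulrC; apply: le_lt_trans.
  by rewrite ler_wpM2r ?abs2_ge0// lerDl.
by move=> a; apply: eq_Re_scale => c; rewrite mulr0 ReD0.
Qed.

(** * Limits of finite sums, products and powers *)

Section CvgAlgebra.
Context {K : numFieldType} {T : Type} {F : set_system T} {FF : Filter F}.

Lemma cvg_bigsum (J : Type) (r : seq J) (u : J -> T -> K) (l : J -> K) :
  (forall j, u j x @[x --> F] --> l j) ->
  \sum_(j <- r) u j x @[x --> F] --> \sum_(j <- r) l j.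
Proof. by move=> ul; apply: cvg_big => //; exact: add_continuous. Qed.

Lemma cvg_bigprod (J : Type) (r : seq J) (P : pred J) (u : J -> T -> K) (l : J -> K) :
  (forall j, P j -> u j x @[x --> F] --> l j) ->
  \prod_(j <- r | P j) u j x @[x --> F] --> \prod_(j <- r | P j) l j.
Proof. by move=> ul; apply: cvg_big => //; exact: mul_continuous. Qed.

Lemma cvg_exp (u : T -> K) (l : K) k :
  u x @[x --> F] --> l -> u x ^+ k @[x --> F] --> l ^+ k.
Proof.
move=> ul; elim: k => [|k IH]; first by under eq_fun do rewrite expr0; exact: cvg_cst.
by under eq_fun do rewrite exprS; rewrite exprS; exact: cvgM.
Qed.

End CvgAlgebra.

(** * Polynomials with nonnegative coefficients *)

Section NonnegPoly.
Context {R : realType} {n : nat}.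
Local Notation C := (cplx R).
Implicit Types (p q : mpoly n C) (v : 'I_n -> C) (F : {fset multinom n}).

Definition cnneg p := forall a, 0 <= mcoeff a p.

(** The counterpart of [monomial] for families indexed by ['I_n], the kind of argument that [meval]
    takes. *)
Definition mon v (a : multinom n) : C := \prod_(j < n) v j ^+ a j.

Definition absv v : 'I_n -> C := fun j => `|v j|.

Lemma cnneg1 : cnneg 1.
Proof. by move=> a; rewrite mcoeff1 ler0n. Qed.

Lemma cnnegD p q : cnneg p -> cnneg q -> cnneg (p + q).
Proof. by move=> p0 q0 a; rewrite mcoeffD addr_ge0. Qed.

Lemma cnnegM p q : cnneg p -> cnneg q -> cnneg (p * q).
Proof. by move=> p0 q0 a; rewrite mcoeffM sumr_ge0// => k _; rewrite mulr_ge0. Qed.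

Lemma cnnegX p k : cnneg p -> cnneg (p ^+ k).
Proof.
by move=> p0; elim: k => [|k IH]; rewrite ?expr0 ?exprS; [exact: cnneg1|exact: cnnegM].
Qed.

Lemma cnneg_sum (J : Type) (r : seq J) (u : J -> mpoly n C) :
  (forall j, cnneg (u j)) -> cnneg (\sum_(j <- r) u j).
Proof.
move=> u0; elim/big_ind: _ => //; last exact: cnnegD.
by move=> a; rewrite mcoeff0.
Qed.

(** Nonnegativity of [p] is built in so that the relation passes to products. *)
Definition cle p q := cnneg p /\ cnneg (q - p).

Lemma cnneg_cle p q : cle p q -> cnneg q.
Proof. by move=> [p0 /(cnnegD p0)]; rewrite addrC subrK. Qed.

Lemma cleM p p' q q' : cle p q -> cle p' q' -> cle (p * p') (q * q').
Proof.
move=> pq p'q'; split; first exact: cnnegM pq.1 p'q'.1.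
have -> : q * q' - p * p' = q * (q' - p') + (q - p) * p' by ring.
apply: cnnegD; apply: cnnegM; [exact: cnneg_cle pq|exact: p'q'.2|exact: pq.2|exact: p'q'.1].
Qed.

Lemma cle1 : cle 1 1.
Proof. by split; [exact: cnneg1|move=> a; rewrite subrr mcoeff0]. Qed.

Lemma cleX p q k : cle p q -> cle (p ^+ k) (q ^+ k).
Proof.
by move=> pq; elim: k => [|k IH]; rewrite ?expr0 ?exprS; [exact: cle1|exact: cleM].
Qed.

Lemma meval_fset p F v : {subset msupp p <= F} ->
  meval v p = \sum_(a <- F) mcoeff a p * mon v a.
Proof.
move=> pF; rewrite mevalE.
rewrite (perm_big (enum_fset [fset a in msupp p]%fset)) /=; last first.
  by apply: uniq_perm => [||a]; rewrite ?msupp_uniq ?fset_uniq// !inE.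
apply: sum_fset_sub; first by apply/fsubsetP => a; rewrite !inE => /pF.
by move=> a _; rewrite !inE => /memN_msupp_eq0 ->; rewrite mul0r.
Qed.

Lemma mon_ge0 v a : (forall j, 0 <= v j) -> 0 <= mon v a.
Proof. by move=> v0; rewrite prodr_ge0// => j _; rewrite exprn_ge0. Qed.

Lemma norm_mon v a : `|mon v a| = mon (absv v) a.
Proof. by rewrite /mon normr_prod; apply: eq_bigr => j _; rewrite normrX. Qed.

Lemma psum_le_meval p F v : cnneg p -> (forall j, 0 <= v j) ->
  \sum_(a <- F) mcoeff a p * mon v a <= meval v p.
Proof.
move=> p0 v0; rewrite (meval_fset (F := (F `|` [fset a in msupp p])%fset)).
  by apply: ler_sum_fset; [move=> a; rewrite mulr_ge0// mon_ge0|exact: fsubsetUl].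
by move=> a ap; rewrite !inE ap orbT.
Qed.

Lemma meval_ge0 p v : cnneg p -> (forall j, 0 <= v j) -> 0 <= meval v p.
Proof.
by move=> p0 v0; apply: le_trans (psum_le_meval fset0 p0 v0); rewrite big_seq_fset0.
Qed.

Lemma norm_meval_le p v : cnneg p -> `|meval v p| <= meval (absv v) p.
Proof.
move=> p0; rewrite !mevalE; apply: le_trans (ler_norm_sum _ _ _) _.
apply: ler_sum => a _; rewrite normrM (ger0_norm (p0 a)).
by rewrite -/(mon v a) norm_mon.
Qed.

Lemma meval_cvg {T : Type} {G : set_system T} {FG : Filter G} p
    (u : T -> 'I_n -> C) (l : 'I_n -> C) :
  (forall j, u x j @[x --> G] --> l j) -> meval (u x) p @[x --> G] --> meval l p.
Proof.
move=> ul; rewrite mevalE.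
have -> : (fun x => meval (u x) p) =
    (fun x => \sum_(a <- msupp p) mcoeff a p * \prod_j u x j ^+ a j).
  by apply/funext => x; rewrite mevalE.
apply: (cvg_bigsum (F := G)) => a; apply: (@cvgM _ _ G); first exact: cvg_cst.
by apply: (cvg_bigprod (F := G)) => j _; exact: (cvg_exp (F := G)).
Qed.

End NonnegPoly.

(** * Expansion of the product of inverse powers by geometric series *)

Section GeometricExpansion.
Context {R : realType} {n : nat} (P : 'I_n -> mpoly n (cplx R)) (m : 'I_n -> nat).
Local Notation C := (cplx R).
Implicit Types (p q : mpoly n C) (v : 'I_n -> C) (F : {fset multinom n}).

Hypothesis P_ge0 : forall j, cnneg (P j).
Hypothesis P_const0 : forall j, mcoeff mnm0 (P j) = 0.

(** A polynomial approximation of [invprod]: each geometric series is cut after [K] terms. *)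
Definition trunc K : mpoly n C :=
  \prod_(j < n) (\sum_(k < K) P j ^+ k) ^+ m j.

Definition invprod v : C := \prod_(j < n) (1 - meval v (P j)) ^- m j.

(** The limit coefficient: as the [P j] have no constant term, terms of order [K > mdeg a] no longer
    affect the coefficient at [a]. *)
Definition exp_coef (a : multinom n) : C := mcoeff a (trunc (mdeg a).+1).

Lemma trunc_cle K L : (K <= L)%N -> cle (trunc K) (trunc L).
Proof.
move=> KL; rewrite /trunc; elim/big_ind2: _ => [|p q p' q'|j _]; first exact: cle1.
  exact: cleM.
apply: cleX; split; first by apply: cnneg_sum => k; exact: cnnegX.
rewrite -!(big_mkord predT (fun k => P j ^+ k)) (big_cat_nat (leq0n K) KL)//= addrAC subrr add0r.
by apply: cnneg_sum => k; exact: cnnegX.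
Qed.

(** Congruence modulo the ideal spanned by the monomials of degree at least [d], hence compatible
    with products. *)
Definition agree d p q := forall a, (mdeg a < d)%N -> mcoeff a p = mcoeff a q.

Lemma agreeM d p q p' q' : agree d p q -> agree d p' q' -> agree d (p * p') (q * q').
Proof.
move=> pq p'q' a ad; rewrite !mcoeffM; apply: eq_bigr => -[b c] /= /eqP E.
have bc : (mdeg (b : multinom n) + mdeg (c : multinom n) < d)%N by rewrite -mdegD -E.
by rewrite pq ?p'q'//; apply: leq_ltn_trans bc; [exact: leq_addl|exact: leq_addr].
Qed.

Lemma agree_refl d p : agree d p p.
Proof. by []. Qed.

Lemma agreeX d p q k : agree d p q -> agree d (p ^+ k) (q ^+ k).
Proof.
move=> pq; elim: k => [|k IH]; first by rewrite !expr0; exact: agree_refl.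
by rewrite !exprS; exact: agreeM.
Qed.

Lemma powP_low j k : agree k (P j ^+ k) 0.
Proof.
elim: k => [|k IH] a; first by rewrite ltn0 => /notF [].
rewrite ltnS exprS mcoeff0 mcoeffM => ak.
rewrite big1// => -[b c] /= /eqP E; have [b0|b0] := eqVneq (b : multinom n) mnm0.
  by rewrite b0 P_const0 mul0r.
rewrite (IH c) ?mcoeff0 ?mulr0//.
apply: leq_trans ak.
apply: (@leq_trans (mdeg (b : multinom n) + mdeg (c : multinom n))%N).
  by rewrite -[X in (X < _)%N]add0n ltn_add2r lt0n mdeg_eq0.
by rewrite -mdegD -E.
Qed.

Lemma trunc_stable a K : (mdeg a < K)%N -> mcoeff a (trunc K) = exp_coef a.
Proof.
rewrite /exp_coef; elim: K => [|K IH].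
  by rewrite ltn0 => /notF [].
rewrite ltnS leq_eqVlt => /predU1P[->|aK]; first by [].
rewrite -(IH aK); suff : agree K (trunc K.+1) (trunc K) by apply.
rewrite /trunc; elim/big_ind2: _ => [|p q p' q'|j _]; first exact: agree_refl.
  exact: agreeM.
apply: agreeX; rewrite big_ord_recr /= => b bK.
by rewrite mcoeffD (powP_low j bK) mcoeff0 addr0.
Qed.

Lemma geometric_cvg (z : C) : `|z| < 1 ->
  \sum_(k < K) z ^+ k @[K --> \oo] --> (1 - z)^-1.
Proof.
move=> z1; have z0 : 1 - z != 0.
  by rewrite subr_eq0; apply: contraTneq z1 => <-; rewrite normr1 ltxx.
have -> : (fun K => \sum_(k < K) z ^+ k) = (fun K => (1 - z ^+ K) * (1 - z)^-1).
  apply/funext => K; apply: (mulIf z0); rewrite divfK// mulrC.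
  by rewrite -[RHS]opprB subrX1 -mulNr opprB.
rewrite -[X in _ --> X]mul1r; apply: cvgM; last exact: cvg_cst.
rewrite -[X in _ --> X]subr0; apply: cvgB; first exact: cvg_cst.
have [r rE] : exists r : R, `|z| = of_real r.
  by exists (complex.Re `|z|); exact: ge0_of_real.
have r0 : 0 <= r by rewrite -le_of_real -rE normr_ge0.
have r1 : `|r| < 1 by rewrite ger0_norm// -lt_of_real -rE.
apply/cvgrPdist_lt => e e0.
have /cvgrPdist_lt/(_ _ (gt0_of_real e0))[N _ HN] := cvg_expr r1.
exists N => // K /HN /=; rewrite !sub0r !normrN (ger0_norm (exprn_ge0 _ r0)) => lt_e.
by rewrite normrX rE (ge0_of_real (ltW e0)) -of_realX lt_of_real.
Qed.

Lemma trunc_cvg v : (forall j, `|meval v (P j)| < 1) ->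
  meval v (trunc K) @[K --> \oo] --> invprod v.
Proof.
move=> v1.
have -> : (fun K => meval v (trunc K)) =
    (fun K => \prod_(j < n) (\sum_(k < K) meval v (P j) ^+ k) ^+ m j).
  apply/funext => K; rewrite /trunc rmorph_prod; apply: eq_bigr => j _.
  rewrite rmorphXn rmorph_sum /=; congr (_ ^+ _); apply: eq_bigr => k _.
  by rewrite rmorphXn.
apply: cvg_bigprod => j _; rewrite -exprVn; apply: cvg_exp.
exact: geometric_cvg.
Qed.

(** The coefficients of [trunc K] increase with [K]. Hence the distance at [v] between a partial sum
    and [trunc K0] is at most an increment of the convergent sequence [trunc] at [absv v]. *)
Lemma expansion v : (forall j, meval (absv v) (P j) < 1) ->
  partial_sum (fun a => exp_coef a * mon v a) F @[F --> totally] --> invprod v.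
Proof.
move=> v1.
have av0 j : 0 <= absv v j by exact: normr_ge0.
have nv1 j : `|meval v (P j)| < 1 by apply: le_lt_trans (norm_meval_le _ _) (v1 j).
have nav1 j : `|meval (absv v) (P j)| < 1 by rewrite ger0_norm ?v1// meval_ge0.
have cv := trunc_cvg nv1; have cav := trunc_cvg nav1.
have mono K L : (K <= L)%N -> meval (absv v) (trunc K) <= meval (absv v) (trunc L).
  move=> KL; rewrite -subr_ge0 -mevalB; apply: meval_ge0 => //.
  exact: (trunc_cle KL).2.
apply/totally_cvgP => e e0; have e3 : (0 : C) < of_real (e / 3).
  by rewrite -of_real0 lt_of_real divr_gt0.
have /cvgrPdist_lt/(_ _ e3)[N1 _ HN1] := cv.
have /cvgrPdist_lt/(_ _ e3)[N2 _ HN2] := cav.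
pose K0 := maxn N1 N2.
(* [F] contains the support of [trunc K0], so that the value of this polynomial is a sum over [F];
   [K] is so large that its coefficients on [F] have stabilized. *)
exists [fset a in msupp (trunc K0)]%fset => F supF; rewrite partial_sumE.
pose K := maxn K0 (\max_(a <- F) (mdeg a).+1).
have KF a : a \in F -> mcoeff a (trunc K) = exp_coef a.
  move=> aF; apply: trunc_stable; apply: leq_trans (leq_maxr _ _).
  exact: (leq_bigmax_seq (F := fun a => (mdeg a).+1)).
have -> : of_real e = of_real (e / 3) + (of_real (e / 3) + of_real (e / 3)).
  by rewrite -!of_realD; congr of_real; field.
rewrite -(subrKA (meval v (trunc K0))); apply: le_lt_trans (ler_normD _ _) _.
apply: ltrD; first exact: (HN1 K0 (leq_maxl _ _)).
rewrite (@meval_fset _ _ _ F); last by move=> a aS; apply: (fsubsetP supF); rewrite !inE.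
rewrite -sumrB; apply: le_lt_trans (ler_norm_sum _ _ _) _.
apply: (@le_lt_trans _ _ `|meval (absv v) (trunc K) - meval (absv v) (trunc K0)|).
  rewrite ger0_norm ?subr_ge0 ?mono ?leq_maxl// -mevalB.
  apply: le_trans (psum_le_meval F (trunc_cle (leq_maxl _ _)).2 av0).
  rewrite big_seq [X in _ <= X]big_seq; apply: ler_sum => a aF.
  rewrite -mulrBl normrM norm_mon -KF// mcoeffB distrC ger0_norm//.
  by rewrite -mcoeffB; exact: (trunc_cle (leq_maxl _ _)).2.
rewrite -(subrKA (invprod (absv v))); apply: le_lt_trans (ler_normD _ _) _.
apply: ltrD; last exact: (HN2 K0 (leq_maxr _ _)).
rewrite distrC; apply: (HN2 K) => /=.
by apply: leq_trans (leq_maxl _ _); exact: leq_maxr.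
Qed.

End GeometricExpansion.

(** * Positive regular tuples near the origin *)

Section PositiveRegular.
Context {R : realType} {n : nat} (P : 'I_n -> mpoly n (cplx R)) (m : 'I_n -> nat).
Local Notation C := (cplx R).

Hypothesis P_reg : positive_regular P.

Lemma posreg_cnneg j : cnneg (P j).
Proof. by have [] := P_reg j. Qed.

Lemma posreg_const0 j : mcoeff mnm0 (P j) = 0.
Proof.
have [_ [c [N [Q [_ Qhom ->]]]]] := P_reg j.
rewrite mcoeffD mcoeffZ mcoeffX.
have /negPf -> : mnm1 j != mnm0 :> multinom n.
  by apply/negP => /eqP/(congr1 mdeg); rewrite mdeg1 mdeg0.
rewrite mulr0 add0r raddf_sum big_nat big1//= => k /andP[k2 _].
apply: memN_msupp_eq0; apply/negP => /(dhomog_mf (Qhom k)) /=.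
by rewrite mdeg0 => k0; rewrite -k0 in k2.
Qed.

Lemma meval_at0 j : meval (fun=> 0) (P j) = 0.
Proof.
rewrite mevalE big1// => a _; have [->|a0] := eqVneq a mnm0.
  by rewrite posreg_const0 mul0r.
have /existsP[i ai] : [exists i, a i != 0%N].
  apply: contraNT a0 => /existsPn a0; apply/eqP/mnmP => i.
  by rewrite mnm0E; apply/eqP; have := a0 i; rewrite negbK.
by rewrite (bigD1 i)//= expr0n (negPf ai) mul0r mulr0.
Qed.

Lemma near0_meval_lt1 :
  \forall x \near (0 : 'rV[C]_n), forall j, `|meval ((x : 'rV[C]_n) 0) (P j)| < 1.
Proof.
apply: (@filter_forall _ _ (fun j => [set x : 'rV[C]_n | `|meval (x 0) (P j)| < 1])
  (nbhs (0 : 'rV[C]_n))) => j.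
have : meval ((x : 'rV[C]_n) 0) (P j) @[x --> nbhs (0 : 'rV[C]_n)] --> meval ((0 : 'rV[C]_n) 0) (P j).
  by apply: (meval_cvg (G := nbhs (0 : 'rV[C]_n))) => i; exact: coord_continuous.
have -> : meval ((0 : 'rV[C]_n) 0) (P j) = 0.
  by rewrite -[RHS](meval_at0 j); apply: meval_eq => i; rewrite mxE.
move/cvgrPdist_lt/(_ _ ltr01); apply: filterS => x.
by rewrite sub0r normrN.
Qed.

End PositiveRegular.

(** * Identification of the coefficient function *)

Section Expansion.
Context {R : realType} {n : nat} {P : 'I_n -> mpoly n (cplx R)} {m : 'I_n -> nat}.
Context {A : multinom n -> R}.
Local Notation C := (cplx R).
Implicit Types (v : 'I_n -> C).

Hypothesis P_reg : positive_regular P.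
Hypothesis A_coef : coefficient_function P m A.

Let P_ge0 := posreg_cnneg P_reg.

(** Positive real points suffice for [power_series_unique]. The bound [r <= 1] ensures that squaring
    the coordinates keeps them below [r]. *)
Lemma small_radius : exists r : R, [/\ 0 < r, r <= 1,
  forall x : 'rV[R]_n, (forall j, 0 < x 0 j < r) ->
    partial_sum (fun a => of_real (A a) * monomial (map_mx (@of_real R) x) a) F
      @[F --> totally] --> invprod P m ((map_mx (@of_real R) x) 0)
  & forall x : 'rV[R]_n, (forall j, 0 < x 0 j < r) ->
    forall j, `|meval ((map_mx (@of_real R) x) 0) (P j)| < 1].
Proof.
have [_ near1] := A_coef; have near2 := near0_meval_lt1 P_reg.
have [e e0 be] := iffLR (nbhs_ballP (0 : 'rV[C]_n) _) (filterI near1 near2).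
have r0 := gt0_of_real e0.
have in_ball (x : 'rV[R]_n) : (forall j, 0 < x 0 j < Num.min (complex.Re e) 1) ->
    ball (0 : 'rV[C]_n) e (map_mx (@of_real R) x).
  move=> xr; split=> // i j; rewrite !mxE (ord1 i) /ball /= sub0r normrN.
  have /andP[x0] := xr j; rewrite lt_min => /andP[xe _].
  by rewrite ger0_norm -?of_real0 ?le_of_real ?(ltW x0)// (ge0_of_real (ltW e0)) lt_of_real.
exists (Num.min (complex.Re e) 1); split.
- by rewrite lt_min r0 ltr01.
- by rewrite ge_min lexx orbT.
- by move=> x /in_ball/be[].
- by move=> x /in_ball/be[].
Qed.

Lemma absv_of_real (x : 'rV[R]_n) : (forall j, 0 <= x 0 j) ->
  absv ((map_mx (@of_real R) x) 0) =1 (map_mx (@of_real R) x) 0.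
Proof. by move=> x0 j; rewrite /absv mxE ger0_norm// -of_real0 le_of_real. Qed.

(** Both series converge to [invprod] at small positive real points, so their coefficients
    coincide. *)
Lemma A_exp_coef a : of_real (A a) = exp_coef P m a.
Proof.
have [r [r0 r1 cvA xP]] := small_radius.
apply/eqP; rewrite -subr_eq0; apply/eqP; move: a.
apply: (power_series_unique r0) => x xr; have x0 j : 0 <= x 0 j.
  by have /andP[/ltW] := xr j.
have av := absv_of_real x0.
have := @expansion _ _ P m P_ge0 (posreg_const0 P_reg) ((map_mx (@of_real R) x) 0).
move=> /(_ _)/wrap[].
  move=> j; rewrite (meval_eq _ av); apply: le_lt_trans (xP x xr j).
  by rewrite real_ler_norm// ger0_real// meval_ge0// => i; rewrite -av; exact: normr_ge0.
move=> cvE; have := @cvgB _ _ _ _ totally_filter _ _ _ _ (cvA x xr) cvE.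
rewrite subrr; apply: cvg_trans; apply: near_eq_cvg; apply: nearW => F.
rewrite !fctE !partial_sumE -sumrB; apply: eq_bigr => a _.
by rewrite mulrBl.
Qed.

End Expansion.

(** * Kernel expansion and independence of the basis functions on the triangle *)

Section Triangle.
Context {R : realType} {n : nat} {P : 'I_n -> mpoly n (cplx R)} {m : 'I_n -> nat}.
Context {A : multinom n -> R}.
Local Notation C := (cplx R).
Implicit Types (v u : 'I_n -> C) (p : mpoly n C).

Hypothesis P_reg : positive_regular P.
Hypothesis A_coef : coefficient_function P m A.

Let P_ge0 := posreg_cnneg P_reg.

Lemma monM v u a : mon (fun j => v j * u j) a = mon v a * mon u a.
Proof. by rewrite /mon -big_split; apply: eq_bigr => j _; rewrite exprMn. Qed.

Lemma mon_conj v a : mon (fun j => (v j)^* ) a = (mon v a)^*.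
Proof. by rewrite /mon rmorph_prod; apply: eq_bigr => j _; rewrite rmorphXn. Qed.

(** AM-GM applied to each monomial, weighted by the nonnegative coefficients. *)
Lemma meval_amgm p v u : cnneg p ->
  meval (absv (fun j => v j * (u j)^* )) p <=
  (meval (fun j => v j * (v j)^* ) p + meval (fun j => u j * (u j)^* ) p) / 2.
Proof.
move=> p0; rewrite !mevalE -big_split mulr_suml; apply: ler_sum => a _ /=.
rewrite -mulrDr -mulrA ler_wpM2l//.
rewrite -!/(mon _ _) !monM !mon_conj -!normCK -norm_mon monM mon_conj normrM norm_conjC.
by apply: (real_leif_mean_square _ _).1; exact: normr_real.
Qed.

Lemma hadamard_conjE (z w : 'rV[C]_n) :
  (hadamard z (conj_row w)) 0 =1 (fun j => z 0 j * (w 0 j)^* ).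
Proof. by move=> j; rewrite !mxE. Qed.

(** This is the domain condition of [expansion] for two distinct points, although the triangle is
    defined by its diagonal case only. *)
Lemma triangle_pair (z w : triangle P) j :
  meval (absv (hadamard (phi (\val z)) (conj_row (phi (\val w))) 0)) (P j) < 1.
Proof.
have lt1 (y : triangle P) :
    meval (fun j => phi (\val y) 0 j * (phi (\val y) 0 j)^* ) (P j) < 1.
  rewrite -(meval_eq _ (hadamard_conjE _ _)).
  by have [_] := set_mem (valP y); apply.
have absE := hadamard_conjE (phi (\val z)) (phi (\val w)).
rewrite (meval_eq (v2 := absv (fun j => phi (\val z) 0 j * (phi (\val w) 0 j)^* ))); last first.
  by move=> i; rewrite /absv absE.
apply: le_lt_trans (meval_amgm _ _ (P_ge0 j)) _.
by rewrite ltr_pdivrMr// mul1r -[2]/(1 + 1) ltrD.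
Qed.

Lemma tail_prod_conj (z w : 'rV[C]_n) :
  tail_prod (hadamard z (conj_row w)) = tail_prod z * (tail_prod w)^*.
Proof.
by rewrite /tail_prod rmorph_prod -big_split; apply: eq_bigr => j _; rewrite hadamard_conjE.
Qed.

Lemma triangle_kernelE (z w : triangle P) :
  partial_sum (fun a => basis_fun P A a z * (basis_fun P A a w)^* ) F
    @[F --> totally] --> triangle_kernel P m z w.
Proof.
pose x := hadamard (phi (\val z)) (conj_row (phi (\val w))).
pose t := (tail_prod (hadamard (\val z) (conj_row (\val w))))^-1.
have cvx := @expansion _ _ P m P_ge0 (posreg_const0 P_reg) (x 0) (triangle_pair z w).
have := totally_cvgZ (c := t) cvx.
apply: cvg_trans; apply: near_eq_cvg; apply: nearW => F.
rewrite !partial_sumE mulr_sumr; apply: eq_bigr => a _.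
rewrite -(A_exp_coef P_reg A_coef) /basis_fun /t tail_prod_conj !rmorphM /= fmorphV invfM.
rewrite conj_of_real.
have -> : mon (x 0) a = monomial (phi (\val z)) a * (monomial (phi (\val w)) a)^*.
  rewrite -[monomial (phi (\val w)) a]/(mon (phi (\val w) 0) a) -mon_conj -monM.
  by apply: eq_bigr => j _; rewrite /x hadamard_conjE.
have A0 : 0 <= A a by apply/ltW; have [/(_ a)] := A_coef.
rewrite -{1}(sqr_sqrtr A0) expr2 of_realM; ring.
Qed.

(** The solution of z_j / z_(j+1) = x_j, found from the last coordinate backwards. *)
Definition phi_inv (x : 'rV[C]_n) : 'rV[C]_n :=
  \row_j \prod_(i < n | (j <= i)%N) x 0 i.

Lemma phi_invK (x : 'rV[C]_n) : (forall j, x 0 j != 0) -> phi (phi_inv x) = x.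
Proof.
move=> x0; apply/rowP => j; rewrite !mxE; case: ifPn => [jn|].
  rewrite (bigD1 j)//= (eq_bigl (fun i : 'I_n => (ordS j <= i)%N)) => [|i].
    by rewrite mulfK//; apply/prodf_neq0 => i _.
  by rewrite /= modn_small// andbC -val_eqE eq_sym ltn_neqAle.
rewrite -leqNgt => nj; rewrite (bigD1 j)//= big1 ?mulr1// => i /andP[ji].
rewrite -val_eqE => /negP[]; rewrite /= eqn_leq ji andbT -ltnS.
exact: leq_trans (ltn_ord i) nj.
Qed.

(** Pulled back along [phi_inv] and multiplied by the tail product, the series becomes a power
    series in small positive [x] with coefficients [D a] times the square root of [A a]. *)
Lemma basis_fun_indep (D : multinom n -> C) :
  (forall z : triangle P,
    partial_sum (fun a => D a * basis_fun P A a z) F @[F --> totally] --> (0 : C)) ->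
  forall a, D a = 0.
Proof.
move=> D0 a; have [r [r0 r1 _ xP]] := small_radius P_reg A_coef.
have sA0 b : of_real (Num.sqrt (A b)) != 0 :> C.
  have Ab : 0 < A b by have [/(_ b)] := A_coef.
  by rewrite gt_eqF// -of_real0 lt_of_real sqrtr_gt0.
suff : D a * of_real (Num.sqrt (A a)) = 0.
  by move/eqP; rewrite mulf_eq0 (negPf (sA0 a)) orbF => /eqP.
apply: (power_series_unique (D := fun a => D a * of_real (Num.sqrt (A a))) r0) => x xr.
pose y : 'rV[C]_n := map_mx (@of_real R) x.
have y0 j : y 0 j != 0.
  by rewrite mxE gt_eqF// -of_real0 lt_of_real; have /andP[] := xr j.
have zt : triangle P (phi_inv y).
  split=> [j _|j]; first by rewrite mxE; apply/prodf_neq0 => i _.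
  (* Membership in the triangle tests the [P j] at the squared coordinates, which are again in the
     range given by [small_radius]. *)
  rewrite phi_invK//; pose x2 : 'rV[R]_n := \row_j x 0 j ^+ 2.
  have x2r i : 0 < x2 0 i < r.
    have /andP[xi0 xir] := xr i.
    rewrite mxE exprn_gt0//= expr2; apply: le_lt_trans xir.
    by rewrite ger_pMr// ltW// (lt_le_trans _ r1)//; have /andP[] := xr i.
  have E : hadamard y (conj_row y) 0 =1 (map_mx (@of_real R) x2) 0.
    by move=> i; rewrite !mxE conj_of_real -of_realM expr2.
  rewrite (meval_eq _ E); apply: le_lt_trans (xP x2 x2r j).
  rewrite real_ler_norm// ger0_real// meval_ge0// => i.
  by rewrite mxE -of_real0 le_of_real; have /andP[/ltW] := x2r i.
pose z : triangle P := SigSub (mem_set zt).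
have t0 : tail_prod (phi_inv y) != 0.
  by apply/prodf_neq0 => j _; rewrite mxE; apply/prodf_neq0 => i _.
have := totally_cvgZ (c := tail_prod (phi_inv y)) (D0 z).
rewrite mulr0; apply: cvg_trans; apply: near_eq_cvg; apply: nearW => F.
rewrite !partial_sumE mulr_sumr; apply: eq_bigr => b _.
by rewrite /basis_fun /= phi_invK// mulrC !mulrA mulfVK.
Qed.

End Triangle.

(** * Boundedness of the kernel diagonal on compact sets *)

Lemma set_type_nbhs (X : topologicalType) (S : set X) (z : S) (U : set X) :
  nbhs (\val z) U -> nbhs z (\val @^-1` U : set S).
Proof.
have := @initial_continuous S X set_val; rewrite set_valE => val_cont.
exact: val_cont.
Qed.

Section KernelDiagonal.
Context {R : realType} {n : nat} {P : 'I_n -> mpoly n (cplx R)} {m : 'I_n -> nat}.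
Local Notation C := (cplx R).

(** The diagonal of the kernel extended to all row vectors, so that continuity is proved in the
    ambient space and then restricted to the triangle. *)
Definition kernel_diag (z : 'rV[C]_n) : C :=
  (\prod_(j < n | (0 < j)%N) `|z 0 j| ^+ 2)^-1 *
  \prod_(j < n) (1 - meval (fun i => `|phi z 0 i| ^+ 2) (P j)) ^- m j.

Lemma kernel_diagE (z : triangle P) : triangle_kernel P m z z = kernel_diag (\val z).
Proof.
rewrite /triangle_kernel /kernel_diag; congr (_^-1 * _).
  by apply: eq_bigr => j _; rewrite hadamard_conjE normCK.
apply: eq_bigr => j _; congr ((1 - _) ^- _).
by apply: meval_eq => i; rewrite hadamard_conjE normCK.
Qed.

Lemma kernel_diag_cvg (z : 'rV[C]_n) : triangle P z ->
  kernel_diag y @[y --> nbhs z] --> kernel_diag z.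
Proof.
move=> [z0 zP]; have zj j : (y : 'rV[C]_n) 0 j @[y --> nbhs z] --> z 0 j.
  exact: coord_continuous.
have phij j : phi (y : 'rV[C]_n) 0 j @[y --> nbhs z] --> phi z 0 j.
  have phiE (y : 'rV[C]_n) : phi y 0 j = if (j.+1 < n)%N then y 0 j / y 0 (ordS j) else y 0 j.
    by rewrite mxE.
  rewrite phiE; under eq_fun do rewrite phiE; case: ifPn => [jn|_]; last exact: zj.
  apply: (@cvgM _ _ (nbhs z)); first exact: zj.
  apply: (@cvgV _ _ (nbhs z)); last exact: zj.
  (* For [j.+1 < n] the index [ordS j] does not wrap around to 0, so this coordinate of [z] is
     nonzero. *)
  by apply: z0; rewrite /= modn_small.
have norm2 (u : 'rV[C]_n -> C) l : u y @[y --> nbhs z] --> l ->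
    `|u y| ^+ 2 @[y --> nbhs z] --> `|l| ^+ 2.
  by move=> ul; apply: (cvg_exp (F := nbhs z)); exact: (@cvg_norm _ _ _ (nbhs z)).
apply: (@cvgM _ _ (nbhs z)).
  apply: (@cvgV _ _ (nbhs z)).
    by apply/prodf_neq0 => j j0; rewrite expf_neq0// normr_eq0 z0.
  by apply: (cvg_bigprod (F := nbhs z)) => j _; exact: norm2.
apply: (cvg_bigprod (F := nbhs z)) => j _.
have lt1 : meval (fun i => `|phi z 0 i| ^+ 2) (P j) < 1.
  have := zP j; rewrite (meval_eq (v2 := fun i => `|phi z 0 i| ^+ 2))// => i.
  by rewrite hadamard_conjE normCK.
apply: (@cvgV _ _ (nbhs z)).
  by rewrite expf_neq0// gt_eqF// subr_gt0.
apply: (cvg_exp (F := nbhs z)); apply: (@cvgB _ _ _ (nbhs z)); first exact: cvg_cst.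
by apply: (meval_cvg (G := nbhs z)) => i; exact: norm2.
Qed.

Lemma Re_le_near (x y : C) : `|x - y| < 1 ->
  complex.Re y <= `|complex.Re x| + 1.
Proof.
move=> xy; have : of_real (`|complex.Re (x - y)|) < 1 := le_lt_trans (normc_ge_Re _) xy.
rewrite -of_real1 lt_of_real ltr_norml ReD ReN => /andP[+ _].
by have := ler_norm (complex.Re x); lra.
Qed.

(** Continuity bounds the diagonal near each point by some natural number; the covering form of
    compactness yields one number for all of [S]. *)
Lemma kernel_diag_bounded (S : set (triangle P)) : compact S ->
  exists M : R, forall z, S z -> complex.Re (triangle_kernel P m z z) <= M.
Proof.
move=> /compact_near_coveringP/(_ nat \oo
  (fun N z => complex.Re (triangle_kernel P m z z) <= N%:R))[|N _ HN].
  move=> z Sz; have /cvgrPdist_lt/(_ _ ltr01) near_z := kernel_diag_cvg (set_mem (valP z)).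
  have near_val : nbhs z [set y : triangle P |
      `|kernel_diag (\val z) - kernel_diag (\val y)| < 1].
    exact: set_type_nbhs near_z.
  pose k := `|complex.Re (kernel_diag (\val z))| + 1.
  have k0 : 0 <= k by rewrite addr_ge0.
  exists ([set y : triangle P | `|kernel_diag (\val z) - kernel_diag (\val y)| < 1],
    [set N | (Num.bound k <= N)%N]) => /=.
    by split=> //; exists (Num.bound k).
  move=> [y N] /= [yz kN]; rewrite kernel_diagE.
  apply: le_trans (_ : k <= _); last first.
    by apply: le_trans (ltW (archi_boundP k0)) _; rewrite ler_nat.
  exact: Re_le_near.
by exists N%:R => z Sz; apply: (HN N) => //=.
Qed.

End KernelDiagonal.

(** * Rescaled spans, and assembly of the three conclusions *)

Lemma lin_span_rescale (R : realType) (X : Type) (I : choiceType)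
    (e : I -> X -> cplx R) (c : I -> cplx R) : (forall i, c i != 0) ->
  lin_span (fun i => c i *: e i) = lin_span e.
Proof.
move=> c0; apply/seteqP; split=> _ [F [d ->]].
  exists F, (fun i => d i * c i); rewrite !partial_sumE.
  by apply: eq_bigr => i _; rewrite scalerA.
exists F, (fun i => d i / c i); rewrite !partial_sumE.
by apply: eq_bigr => i _; rewrite scalerA divfK.
Qed.

Theorem proposition3p5 (R : realType) (n : nat)
    (P : 'I_n -> mpoly n (cplx R)) (m : 'I_n -> nat)
    (A : multinom n -> R) (H : rkhs (triangle_kernel P m)) :
  (1 < n)%N -> positive_regular P -> (forall j, (0 < m j)%N) ->
  coefficient_function P m A ->
  [/\ orthonormal_basis H (basis_fun P A),
      hdense H (lin_span (span_fun P))
    & forall f, rkhs_carrier H f ->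
        {family compact,
          partial_sum (fun a => ip H f (basis_fun P A a) *: basis_fun P A a) F
            @[F --> totally] --> f}].
Proof.
move=> _ P_reg _ A_coef.
have kernelE := triangle_kernelE P_reg A_coef.
have indep := basis_fun_indep P_reg A_coef.
have onb := e_orthonormal_basis H kernelE indep.
split=> //.
- have [_ _] := onb; congr (hdense H _).
  have -> : basis_fun P A = fun a => of_real (Num.sqrt (A a)) *: span_fun P a.
    by apply/funext => a; apply/funext => z; rewrite /basis_fun -mulrA.
  apply: lin_span_rescale => a; have Aa : 0 < A a by have [/(_ a)] := A_coef.
  by rewrite gt_eqF// -of_real0 lt_of_real sqrtr_gt0.
- move=> f Vf; apply/fam_cvgP => S cS U /uniform_nbhs[E [entE EU]].
  have [M HM] := kernel_diag_bounded (m := m) cS.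
  move: entE; rewrite -entourage_from_ballE => -[d d0 dE].
  (* [M] need not be positive, so its absolute value plus 1 serves as the bound on the diagonal. The
     threshold in [d1] makes the squared norm of the remainder times this bound smaller than the
     square of [d]. *)
  have M0 : 0 < `|M| + 1 by rewrite ltr_wpDl.
  have d1 : 0 < complex.Re d ^+ 2 / (`|M| + 1).
    by rewrite divr_gt0// exprn_gt0// gt0_of_real.
  have [F0 HF] := proj_cvg kernelE indep Vf d1.
  exists F0 => // F /HF Flt; apply: EU => z Sz; apply: dE => /=.
  rewrite /ball /= (ge0_of_real (ltW d0)) partial_sumE norm_lt_abs2 ?gt0_of_real//.
  have projE : (\sum_(a <- F) ip H f (basis_fun P A a) *: basis_fun P A a) z =
    proj H (basis_fun P A) f F z by [].
  rewrite projE; apply: le_lt_trans (proj_pointwise kernelE F z Vf) _.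
  have VP : rkhs_carrier H (f - proj H (basis_fun P A) f F).
    by apply: carrierB => //; exact: ecombV.
  apply: (@le_lt_trans _ _ (sqn H (f - proj H (basis_fun P A) f F) * (`|M| + 1))).
    rewrite ler_wpM2l ?sqn_ge0//; apply: le_trans (HM z Sz) _.
    by apply: le_trans (ler_norm M) _; rewrite lerDl.
  by rewrite -ltr_pdivlMr.
Qed.
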